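(* Let $\mathbf{X}$ be an isotropic unimodal Lévy process on $\mathbb{R}^d$ with Lévy–Khintchine exponent $\psi\in\Pi^\infty_\ell$ for some bounded $\ell\in\mathcal{R}^\infty_0$. Then there exist $r_0,t_0>0$ and $C\ge1$ such that for all $t\in(0,t_0)$ and $0<|x|\le r_0$, \[ C^{-1}\,t|x|^{-d}\ell(|x|^{-1})e^{-t\psi(|x|^{-1})}\le p(t,x)\le C\,t|x|^{-d}\ell(|x|^{-1})e^{-t\psi(|x|^{-1})}. \]
   Context: An isotropic unimodal Lévy process on $\mathbb{R}^d$ is a pure-jump Lévy process $\mathbf{X}=(X_t)_{t\ge0}$, $X_0=0$, with $\mathbb{E}e^{i\langle\xi,X_t\rangle}=e^{-t\psi(\xi)}$, $\psi(\xi)=\int_{\mathbb{R}^d}(1-\cos\langle\xi,x\rangle)\,\nu(\mathrm{d}x)$, where the Lévy measure has a radial, radially non-increasing density; for $t>0$ the law of $X_t$ on $\mathbb{R}^d\setminus\{0\}$ has a radial non-increasing density $p(t,x)$. Radial functions are written as functions of $|x|$. $\ell\in\mathcal{R}^\infty_0$ means $\ell$ positive on some $[a,\infty)$ with $\ell(\lambda x)/\ell(x)\to1$ as $x\to\infty$ for all $\lambda>0$; $\Pi^\infty_\ell$ is the set of $f:[a,\infty)\to[0,\infty)$ with $\lim_{x\to\infty}(f(\lambda x)-f(x))/\ell(x)=\log\lambda$ for all $\lambda>0$. *)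

(* Defs.v *)
(* mathcomp-analysis over an abstract R : realType.
   R^d is represented as d.-tuple R with its canonical (product = Borel)
   sigma-algebra from mathcomp-analysis (measure_tuple_display). *)
From mathcomp Require Import all_boot all_order all_algebra.
From mathcomp Require Import all_classical all_reals all_analysis.
Set Implicit Arguments. Unset Strict Implicit. Unset Printing Implicit Defensive.
Import Order.TTheory GRing.Theory Num.Theory.
Import numFieldNormedType.Exports.
Local Open Scope ring_scope.
Local Open Scope classical_set_scope.

Section Rd.
Variable R : realType.

Definition vdot (d : nat) (x y : d.-tuple R) : R :=
  \sum_(i < d) tnth x i * tnth y i.
Definition vnorm (d : nat) (x : d.-tuple R) : R := Num.sqrt (vdot x x).
Definition vzero (d : nat) : d.-tuple R := [tuple (0 : R) | i < d].
Definition vsub (d : nat) (x y : d.-tuple R) : d.-tuple R :=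
  [tuple tnth x i - tnth y i | i < d].

(* Integral with respect to d-dimensional Lebesgue measure, written as the
   iterated one-dimensional Lebesgue integral (x_0 outermost).  For the
   nonnegative measurable integrands used below this is the integral against
   the d-fold product Lebesgue measure (Tonelli). *)
Fixpoint leb_int (d : nat) : (d.-tuple R -> \bar R) -> \bar R :=
  match d with
  | 0 => fun f => f [tuple]
  | d'.+1 => fun f =>
      (\int[@lebesgue_measure R]_x leb_int (fun t : d'.-tuple R => f [tuple of x :: t]))%E
  end.

(* Mutual independence of a finite family of R^d-valued random variables:
   product rule for every choice of Borel sets (taking some sets = setT
   gives the product rule for every subfamily). *)
Definition mutually_independent (dT : measure_display) (T : measurableType dT)
    (P : probability T R) (d m : nat) (Y : 'I_m -> T -> d.-tuple R) : Prop :=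
  forall A : 'I_m -> set (d.-tuple R), (forall i, measurable (A i)) ->
    P (\bigcap_(i in [set: 'I_m]) (Y i @^-1` A i)) =
    (\prod_(i < m) P (Y i @^-1` A i))%E.

Definition levy_process (dT : measure_display) (T : measurableType dT)
    (P : probability T R) (d : nat) (X : R -> T -> d.-tuple R) : Prop :=
  [/\ (forall t, 0 <= t -> measurable_fun setT (X t)),
      (forall w, X 0 w = vzero d),
      (forall (n : nat) (ts : 'I_n.+2 -> R),
          0 <= ts ord0 -> (forall i j : 'I_n.+2, (i < j)%N -> ts i < ts j) ->
          mutually_independent P
            (fun (i : 'I_n.+1) w => vsub (X (ts (lift ord0 i)) w)
                                         (X (ts (widen_ord (leqnSn _) i)) w))),
      (forall s t : R, 0 <= s -> 0 <= t ->
          forall A : set (d.-tuple R), measurable A ->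
          P ((fun w => vsub (X (s + t) w) (X s w)) @^-1` A) = P (X t @^-1` A)) &
      (forall eps : R, 0 < eps ->
          P [set w | eps < vnorm (X t w)] @[t --> 0^'+] --> 0%E)].

Definition slowly_varying_inf (l : R -> R) : Prop :=
  exists a : R, (forall x, a <= x -> 0 < l x) /\
    forall lam : R, 0 < lam -> (l (lam * x) / l x) @[x --> +oo%R] --> (1 : R).

Definition Pi_inf (l f : R -> R) : Prop :=
  exists a : R, (forall x, a <= x -> 0 <= f x) /\
    forall lam : R, 0 < lam -> ((f (lam * x) - f x) / l x) @[x --> +oo%R] --> ln lam.

End Rd.

(* Main.v *)
Require Import Defs.
From HB Require Import structures.
From mathcomp Require Import all_boot all_order all_algebra.
From mathcomp Require Import all_classical all_reals all_analysis.
From mathcomp Require Import measurable_realfun ring lra.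
Set Implicit Arguments. Unset Strict Implicit. Unset Printing Implicit Defensive.
Import Order.TTheory GRing.Theory Num.Theory.
Import numFieldNormedType.Exports.
Local Open Scope ring_scope.
Local Open Scope classical_set_scope.

(** The law of [X t] is tested against the kernel [S y - S (2 y)] with
    [S y = \prod_i (1 + y_i ^ 2)^-1], which is nonnegative, vanishes quadratically
    at 0 and is the Fourier transform of a signed measure: [S y] is the mean of
    [cos <Z, y>] when the coordinates of [Z] are independent Laplace variables.
    By Fubini the mean of the kernel at [u (X t)] is the mean of
    [exp (- t psi (u |Z|)) - exp (- t psi (2 u |Z|))], and this is comparable to
    [t * l u * exp (- t psi u)]: since [psi (2 u) - psi u] is comparable to [l u],
    Potter bounds for [l] and the at most logarithmic growth of [psi] leave a
    factor that is integrable in [Z] once [t] is small.  The local uniformity behind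
    the Potter bounds comes from continuity of [psi] and Baire's theorem.
    Monotonicity of [p t] then turns these two-sided bounds into bounds for [p t]:
    the kernel is bounded below on a box of size [r], and it is dominated by the
    indicator of the annulus [r / K <= |x| <= K r] plus [K^-2] times its own
    dilations by [K] and [K^-1], which are absorbed for large [K]. *)

(** * Regular variation *)

Section regular_variation.
Variable R : realType.

(** Taking a difference of two values of [S] is what makes [l] visible: [1 - S y] would lead to
    [1 - exp (- t psi u)], which measures [psi] itself, whereas [S y - S (2 y)] leads to the
    increment of [psi] over one doubling and moreover decays at infinity. On the analytic side the
    obstacle is that [l] comes without measurability, so the classical uniform convergence theorem
    for slowly varying functions cannot be applied to it. Baire's theorem is applied to [psi], which
    is continuous through the characteristic function, and [l] is then controlled as an increment of
    [psi]. The increment of [psi] is governed by [l] only above a threshold [A]. Below it only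
    boundedness remains, and the errors made there are absorbed thanks to a lower bound of order
    [x^(-1/4)] for the profile [l x * exp (- t psi x)]. The final absorption closes because the
    kernel gains [K^-2] while moving the profile by a factor [K] costs less than [K^2]. *)

Lemma baire_cover (E : nat -> set R) :
  (forall n, closed (E n)) -> (forall v, exists n, E n v) ->
  exists n (v : R) (e : R), 0 < e /\ forall w, `|w - v| < e -> E n w.
Proof.
move=> Ecl Ecov; apply: contrapT => H.
have /Baire : forall n, open (~` E n) /\ dense (~` E n).
  move=> n; split; first exact: closed_openC.
  move=> D [x Dx] oD.
  apply/set0P/negP => /eqP DE; apply: H; exists n, x.
  have /nbhs_ballP[e /= e0 be] : nbhs x D by apply: open_nbhs_nbhs.
  exists e; split => // w wxe; apply: contrapT => nEw.
  suff : (D `&` ~` E n) w by rewrite DE.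
  by split => //; apply: be; rewrite /ball/= distrC.
move=> /(_ setT) [||v [_ nv]]; [by exists 0|exact: openT|].
by have [n Env] := Ecov v; exact: (nv n I).
Qed.

(** Logarithmic coordinates: [F s] stands for [psi (exp s)] and [G s] for [l (exp s)], so that
    dilations become translations. [HF] and [HG] hold for each fixed [v] separately; the section
    makes their consequences uniform in [v]. *)
Variables (F G : R -> R) (a M : R).
Hypothesis Fc : continuous F.
Hypothesis Gpos : forall s, a <= s -> 0 < G s.
Hypothesis GM : forall s, a <= s -> G s <= M.
Hypothesis HF : forall v e : R, 0 < e -> exists N : R, forall s, N <= s ->
  `|F (s + v) - F s - v * G s| <= e * G s.
Hypothesis HG : forall v e : R, 0 < e -> exists N : R, forall s, N <= s ->
  `|G (s + v) - G s| <= e * G s.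

(** The sets of steps [v] whose increment is at most [(|v| + 1) * G s] from [n] on are closed by
    continuity of [F] and cover the line by [HF], so one of them contains an interval around some
    [v]. A small step [w] from [s] is then the difference of the steps [v + w] and [v] from [s - v],
    and [G (s - v)] is at most [2 * G s] by [HG]. *)
Lemma increment_bounded_near0 : exists d C N : R,
  [/\ 0 < d, 0 < C & forall w s, `|w| <= d -> N <= s -> `|F (s + w) - F s| <= C * G s].
Proof.
pose E n := [set v : R | forall s, Num.max a n%:R <= s ->
   `|F (s + v) - F s| <= (`|v| + 1) * G s].
have Ecl n : closed (E n).
  have -> : E n = \bigcap_(s in [set s | Num.max a n%:R <= s])
     ((fun v => (`|v| + 1) * G s - `|F (s + v) - F s|) @^-1` [set x | 0 <= x]).
    apply/seteqP; split => v /= Ev s /= sn; have := Ev s sn => /=.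
      by rewrite subr_ge0.
    by rewrite subr_ge0.
  apply: closed_bigI => s _; apply: preimage_closed; last exact: closed_ge.
  move=> v _.
  apply: cvgB; last first.
    apply: cvg_norm; apply: cvgB; last exact: cvg_cst.
    apply: continuous_comp; last exact: Fc.
    apply: cvgD; [exact: cvg_cst|exact: cvg_id].
  apply: cvgM; last exact: cvg_cst.
  apply: cvgD; last exact: cvg_cst.
  by apply: cvg_norm; exact: cvg_id.
have Ecov v : exists n, E n v.
  have [N HN] := HF v (ltr01).
  pose n := Num.bound `|N|; exists n => s; rewrite ge_max => /andP[sa sn].
  have sN : N <= s.
    apply: le_trans sn; apply/ltW/(le_lt_trans (ler_norm _)).
    exact: archi_boundP (normr_ge0 N).
  have := HN _ sN.
  have G0 := Gpos sa.
  have := ler_normD (F (s + v) - F s - v * G s) (v * G s).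
  rewrite subrK normrM (gtr0_norm G0); lra.
have [n [v [e [e0 He]]]] := baire_cover Ecl Ecov.
have [N HN] := HG (- v) ltr01.
exists (e / 2), (2 * (2 * (`|v| + e + 1))), (Num.max (Num.max a n%:R + v) (Num.max a N)).
split; [lra|by have := normr_ge0 v; lra|].
move=> w s we; rewrite !ge_max => /and3P[sv sa' sN].
have h1 : Num.max a n%:R <= s - v by lra.
have h1' : a <= s - v by move: h1; rewrite ge_max => /andP[].
have /(He _)/(_ _ h1) : `|(v + w) - v| < e by rewrite (addrC v) addrK; lra.
have /(He _)/(_ _ h1) : `|v - v| < e by rewrite subrr normr0.
have -> : s - v + v = s by lra.
have -> : s - v + (v + w) = s + w by lra.
have := HN _ sN.
have := Gpos sa'.
have := Gpos h1'.
have := ler_normD v w.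
set g := G (s - v); set g' := G s => nvw g0 g'0 hg hw1 hw2.
have gg' : g <= 2 * g' by move: hg; rewrite ler_norml => /andP[]; lra.
have hF : `|F (s + w) - F s| <= (`|v| + 1) * g + (`|v + w| + 1) * g.
  have -> : F (s + w) - F s = - (F s - F (s - v)) + (F (s + w) - F (s - v)) by lra.
  by apply: (le_trans (ler_normD _ _)); rewrite normrN lerD.
apply: (le_trans hF); rewrite -mulrDl.
apply: (@le_trans _ _ ((2 * (`|v| + e + 1)) * (2 * g'))); last by lra.
have nv := normr_ge0 v; have nvw' := normr_ge0 (v + w).
by apply: ler_pM; [lra|exact: ltW|lra|].
Qed.

(** Steps up to 1 are made of finitely many steps of size at most [d], and [G] at most doubles at
    each of them. *)
Lemma increment_bounded : exists C N : R,
  [/\ 0 < C & forall w s, `|w| <= 1 -> N <= s -> `|F (s + w) - F s| <= C * G s].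
Proof.
have [d [C [N [d0 C0 H]]]] := increment_bounded_near0.
suff [C' [N' [C'0 H']]] : exists C' N' : R, [/\ 0 < C' & forall w s,
    `|w| <= (Num.bound d^-1)%:R * d -> N' <= s -> `|F (s + w) - F s| <= C' * G s].
  exists C', N'; split => // w s w1; apply: H'; apply: (le_trans w1).
  rewrite -ler_pdivrMr// mul1r ltW// archi_boundP// invr_ge0 ltW//.
elim: (Num.bound d^-1) => [|k [C' [N' [C'0 IH]]]].
  exists C, (Num.max a N); split => // w s; rewrite mul0r normr_le0 => /eqP ->.
  rewrite ge_max => /andP[/Gpos/ltW G0 _].
  by rewrite addr0 subrr normr0 mulr_ge0// ltW.
have [N1 H1] := HG d ltr01.
have [N2 H2] := HG (- d) ltr01.
exists (C' * 2 + C), (Num.max (Num.max N (N' + d)) (Num.max a (Num.max N1 N2))).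
split; first lra.
move=> w s wk; rewrite !ge_max => /andP[/andP[sN sN'] /and3P[sa sN1 sN2]].
have G0 := Gpos sa.
have step c : `|c| <= d -> N' <= s + c -> `|w - c| <= k%:R * d ->
    G (s + c) <= 2 * G s -> `|F (s + w) - F s| <= (C' * 2 + C) * G s.
  move=> cd Nc wc Gc.
  have -> : F (s + w) - F s = (F (s + c + (w - c)) - F (s + c)) + (F (s + c) - F s).
    by rewrite (_ : s + c + (w - c) = s + w); lra.
  apply: (le_trans (ler_normD _ _)); rewrite mulrDl; apply: lerD; last exact: H.
  apply: (le_trans (IH _ _ wc Nc)); rewrite -mulrA; apply: ler_wpM2l => //; exact: ltW.
move: wk; rewrite -natr1 mulrDl mul1r => wk.
have [wd|wd] := lerP `|w| d.
  apply: (le_trans (H _ _ wd sN)); rewrite ler_wpM2r ?(ltW G0)//; lra.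
have [w0|w0] := lerP 0 w.
  apply: (step d); [by rewrite gtr0_norm|lra| |].
    move: wk wd; rewrite (ger0_norm w0) => *; rewrite ger0_norm; lra.
  have := H1 _ sN1; rewrite ler_norml => /andP[]; lra.
apply: (step (- d)); [by rewrite normrN gtr0_norm|lra| |].
  move: wk wd; rewrite (ltr0_norm w0) => *; rewrite ler0_norm; lra.
have := H2 _ sN2; rewrite ler_norml => /andP[]; lra.
Qed.

(** [G (s + v)] is at most twice the unit increment of [F] at [s + v], and this increment splits
    into three increments of [F] based at [s] and [s + 1]. In this way the uniformity known for [F]
    passes to [G]. *)
Lemma auxiliary_bounded : exists C N : R,
  [/\ 0 < C & forall v s, `|v| <= 1 -> N <= s -> G (s + v) <= C * G s].
Proof.
have [C [N [C0 H]]] := increment_bounded.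
have [N1 H1] := HF 1 (divr_gt0 ltr01 (ltr0n R 2)).
have [N2 H2] := HG 1 ltr01.
exists (8 * C), (Num.max (N + 1) (Num.max (N1 + 1) (Num.max N2 (a + 1)))); split; first lra.
move=> v s v1; rewrite !ge_max => /and4P[sN sN1 sN2 sa].
have vb : - 1 <= v <= 1 by rewrite -ler_norml.
have G0 : 0 < G s by apply: Gpos; lra.
have G1 : 0 < G (s + v) by apply: Gpos; lra.
have /H1 : N1 <= s + v by lra.
have := H v _ v1 (_ : N <= s + 1).
have := H v _ v1 (_ : N <= s).
have := H 1 _ (_ : `|1| <= 1) (_ : N <= s).
rewrite normr1 !ler_norml.
move=> /(_ (lexx 1)) /(_ ltac:(lra)) /andP[h1 h2] /(_ ltac:(lra)) /andP[h3 h4] /(_ ltac:(lra)) /andP[h5 h6] /andP[h7 h8].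
have := H2 _ sN2; rewrite ler_norml => /andP[h9 h10].
have e1 : s + 1 + v = s + v + 1 by lra.
rewrite e1 in h5 h6.
have : C * G (s + 1) <= C * (2 * G s) by apply: ler_wpM2l; [exact: ltW|lra].
lra.
Qed.

Lemma nat_frac_decomp (s s' : R) : s <= s' ->
  exists k (v : R), [/\ s' = s + k%:R + v, 0 <= v & v <= 1].
Proof.
move=> ss'; have ss0 : 0 <= s' - s by rewrite subr_ge0.
have /andP[h1 h2] := truncn_itv ss0.
exists (Num.truncn (s' - s)), (s' - s - (Num.truncn (s' - s))%:R).
by move: h2; rewrite -natr1 => h2; split; lra.
Qed.

Lemma potter_bound (eta : R) : 0 < eta -> exists C N : R,
  [/\ 0 < C & forall s s', N <= s -> s <= s' ->
    G s <= C * expR (eta * (s' - s)) * G s' /\ G s' <= C * expR (eta * (s' - s)) * G s].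
Proof.
move=> eta0; have [C [N0 [C0 H]]] := auxiliary_bounded.
(* With this tolerance [G (s + 1) / G s] lies between [exp (- eta)] and [2 - exp (- eta)], and the
   latter is at most [exp eta]. *)
have eta1 : 0 < 1 - expR (- eta) by rewrite subr_gt0 expR_lt1 oppr_lt0.
have [N1 H1] := HG 1 eta1.
have expR1 : expR eta >= 1 + eta by exact: expR_ge1Dx.
have exp1 : expR eta * expR (- eta) = 1 by rewrite -expRD subrr expR0.
have step s : Num.max a N1 <= s -> G s <= expR eta * G (s + 1) /\ G (s + 1) <= expR eta * G s.
  rewrite ge_max => /andP[sa sN]; have G0 := Gpos sa.
  have G1 : 0 < G (s + 1) by apply: Gpos; lra.
  have := H1 _ sN; rewrite ler_norml => /andP[h1 h2].
  have eN0 := expR_gt0 (- eta); have e0 := expR_gt0 eta.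
  split.
    have : expR eta * (expR (- eta) * G s) <= expR eta * G (s + 1).
      by rewrite ler_pM2l//; lra.
    by rewrite mulrA exp1 mul1r.
  have : (2 - expR (- eta)) * G s <= expR eta * G s.
    rewrite ler_pM2r//; have : (expR eta - 1) ^+ 2 >= 0 by exact: sqr_ge0.
    rewrite -(ler_pM2l e0) mulrBr exp1; nra.
  nra.
have stepk k s : Num.max a N1 <= s -> G s <= expR (eta * k%:R) * G (s + k%:R) /\
    G (s + k%:R) <= expR (eta * k%:R) * G s.
  move=> sN; elim: k => [|k [IH1 IH2]]; first by rewrite mulr0 expR0 addr0 mul1r.
  have /step [h1 h2] : Num.max a N1 <= s + k%:R.
    by apply: (le_trans sN); rewrite lerDl.
  rewrite -natr1 mulrDr mulr1 expRD addrA; split.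
    by apply: (le_trans IH1); rewrite -mulrA ler_pM2l ?expR_gt0.
  by apply: (le_trans h2); rewrite (mulrC (expR (eta * k%:R))) -mulrA ler_pM2l ?expR_gt0.
exists C, (Num.max (N0 + 1) (Num.max a N1)); split => // s s'.
rewrite ge_max => /andP[sN0 sN1] ss'.
have [k [v [-> v0 v1]]] := nat_frac_decomp ss'.
have [h1 h2] := stepk k s sN1.
have k0 : 0 <= k%:R :> R by [].
have G1 : 0 < G (s + k%:R) by apply: Gpos; move: sN1; rewrite ge_max; lra.
have G0 : 0 < G s by apply: Gpos; move: sN1; rewrite ge_max; lra.
have G2 : 0 < G (s + k%:R + v) by apply: Gpos; move: sN1; rewrite ge_max; lra.
have ek : expR (eta * k%:R) <= expR (eta * (s + k%:R + v - s)).
  by rewrite ler_expR ler_pM2l//; lra.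
have := H (- v) (s + k%:R + v); rewrite normrN ger0_norm// addrK => /(_ v1 ltac:(lra)) h3.
have := H v (s + k%:R); rewrite ger0_norm// => /(_ v1 ltac:(lra)) h4.
split.
  apply: (le_trans h1); rewrite (mulrC C) -mulrA.
  by apply: ler_pM => //; exact: ltW.
apply: (le_trans h4); rewrite -mulrA ler_pM2l//.
by apply: (le_trans h2); rewrite ler_pM2r.
Qed.

(** Unit increments eventually lie between 0 and [2 * M], so only the fractional part of the step
    can make [F] decrease; hence a lower bound that does not depend on [s' - s]. *)
Lemma increment_growth : exists C N : R,
  [/\ 0 < C & forall s s', N <= s -> s <= s' ->
    - C <= F s' - F s <= C * (1 + (s' - s))].
Proof.
have [C [N0 [C0 H]]] := increment_bounded.
have [N1 H1] := HF 1 ltr01.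
have M0 : 0 < M by exact: lt_le_trans (Gpos (lexx a)) (GM (lexx a)).
exists (C * M + 2 * M), (Num.max N0 (Num.max a N1)); split.
  by have := mulr_gt0 C0 M0; lra.
move=> s s'; rewrite !ge_max => /and3P[sN sa sN1] ss'.
have [k [v [-> v0 v1]]] := nat_frac_decomp ss'.
have stepk : 0 <= F (s + k%:R) - F s <= 2 * M * k%:R.
  elim: k {ss'} => [|k IH]; first by rewrite addr0 subrr mulr0 lexx.
  have k0 : 0 <= k%:R :> R by [].
  have /H1 : N1 <= s + k%:R by lra.
  have /GM : a <= s + k%:R by lra.
  have /Gpos : a <= s + k%:R by lra.
  rewrite ler_norml -natr1 addrA; lra.
have k0 : 0 <= k%:R :> R by [].
have := H v (s + k%:R); rewrite ger0_norm// => /(_ v1 ltac:(lra)).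
have : C * G (s + k%:R) <= C * M by rewrite ler_pM2l// GM//; lra.
have : 0 < C * M by exact: mulr_gt0.
rewrite ler_norml => CM h1 h2.
have h3 : 0 <= C * M * (k%:R + v) by apply: mulr_ge0; lra.
have h4 : 0 <= M * v by apply: mulr_ge0; lra.
apply/andP; split; lra.
Qed.

End regular_variation.

(** * The test kernel *)

Section kernel.
Variables (R : realType) (d : nat).
Implicit Types y : 'I_d -> R.

Definition cauchy_prod y : R := \prod_(i < d) (1 + y i ^+ 2)^-1.
Definition cauchy_diff y : R := cauchy_prod y - cauchy_prod (fun i => 2 * y i).
Definition sqnorm y : R := \sum_(i < d) y i ^+ 2.

Lemma cauchy_factor_bounds (x : R) : 0 < (1 + x ^+ 2)^-1 <= 1.
Proof.
have := sqr_ge0 x => x0; rewrite invr_gt0 invf_le1; last by lra.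
by apply/andP; split; lra.
Qed.

Lemma le_cauchy_factor (x z : R) : x ^+ 2 <= z ^+ 2 -> (1 + z ^+ 2)^-1 <= (1 + x ^+ 2)^-1.
Proof.
by have := sqr_ge0 x; have := sqr_ge0 z => *; rewrite lef_pV2 ?posrE; lra.
Qed.

Lemma cauchy_prod_bounds y : 0 < cauchy_prod y <= 1.
Proof.
apply/andP; split.
  by apply: prodr_gt0 => i _; have /andP[] := cauchy_factor_bounds (y i).
by apply: prodr_ile1 => i _; have /andP[/ltW -> ->] := cauchy_factor_bounds (y i).
Qed.

Lemma le_cauchy_factor_others y z i : (forall j, y j ^+ 2 <= z j ^+ 2) ->
  \prod_(j < d | j != i) (1 + z j ^+ 2)^-1 <= \prod_(j < d | j != i) (1 + y j ^+ 2)^-1.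
Proof.
move=> yz; apply: ler_prod => j _; rewrite le_cauchy_factor// andbT.
by have /andP[/ltW] := cauchy_factor_bounds (z j).
Qed.

(** Doubling the other coordinates only lowers their factors, so the decrease is at least the one
    due to coordinate [i] alone, and [1 - (1 + y^2) / (1 + 4 y^2) = 3 y^2 / (1 + 4 y^2)]. *)
Lemma cauchy_diff_ge y i :
  cauchy_prod y * (3 * y i ^+ 2 / (1 + 4 * y i ^+ 2)) <= cauchy_diff y.
Proof.
rewrite /cauchy_diff /cauchy_prod (bigD1 i)//= [X in _ <= _ - X](bigD1 i)//=.
have h : forall j, y j ^+ 2 <= (2 * y j) ^+ 2 by move=> j; have := sqr_ge0 (y j); lra.
have /= := @le_cauchy_factor_others y (fun j => 2 * y j) i h.
set p := (X in _ <= X -> _); set q := (X in X <= _ -> _) => qp.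
have := sqr_ge0 (y i) => y0.
have h1 : (1 + (2 * y i) ^+ 2)^-1 * q <= (1 + (2 * y i) ^+ 2)^-1 * p.
  by rewrite ler_wpM2l// invr_ge0; have := sqr_ge0 (2 * y i); lra.
have n1 : 1 + y i ^+ 2 != 0 by rewrite gt_eqF//; lra.
have n2 : 1 + 4 * y i ^+ 2 != 0 by rewrite gt_eqF//; lra.
have -> : (1 + y i ^+ 2)^-1 * p * (3 * y i ^+ 2 / (1 + 4 * y i ^+ 2)) =
  (1 + y i ^+ 2)^-1 * p - (1 + (2 * y i) ^+ 2)^-1 * p.
  have -> : (2 * y i) ^+ 2 = 4 * y i ^+ 2 by ring.
  by field; rewrite n1 n2.
exact: (lerB (lexx _) h1).
Qed.

Lemma cauchy_diff_ge0 y : (0 < d)%N -> 0 <= cauchy_diff y.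
Proof.
move=> d0; apply: le_trans (cauchy_diff_ge y (Ordinal d0)).
have /andP[/ltW h _] := cauchy_prod_bounds y.
apply: mulr_ge0 => //; apply: divr_ge0; have := sqr_ge0 (y (Ordinal d0)); lra.
Qed.

Lemma cauchy_diff_le1 y : cauchy_diff y <= 1.
Proof.
have /andP[_ h] := cauchy_prod_bounds y.
have /andP[/ltW h' _] := cauchy_prod_bounds (fun i => 2 * y i).
by rewrite /cauchy_diff; lra.
Qed.

(** The factors are exchanged one at a time, the remaining ones being at most 1. *)
Lemma prod_diff_le n (f g : 'I_n -> R) : (forall i, 0 <= g i <= f i) -> (forall i, f i <= 1) ->
  \prod_i f i - \prod_i g i <= \sum_i (f i - g i).
Proof.
elim: n f g => [|n IH] f g gf f1; first by rewrite !big_ord0 subrr.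
rewrite !big_ord_recl.
have /= h1 := IH (fun i => f (lift ord0 i)) (fun i => g (lift ord0 i)) (fun i => gf _) (fun i => f1 _).
have h2 : 0 <= \prod_(i < n) f (lift ord0 i) <= 1.
  have h i : 0 <= f (lift ord0 i) <= 1.
    by have /andP[a b] := gf (lift ord0 i); rewrite f1 andbT (le_trans a b).
  by rewrite prodr_ge0 ?prodr_ile1// => i _; have /andP[] := h i.
have h3 : \prod_(i < n) g (lift ord0 i) <= \prod_(i < n) f (lift ord0 i).
  by apply: ler_prod.
move: h1 h2 h3 (gf ord0) (f1 ord0).
set F := \prod_(i < n) f _; set G := \prod_(i < n) g _.
move=> h1 h2 h3 h4 h5; have : 0 <= (f ord0 - g ord0) * (1 - F) by apply: mulr_ge0; lra.
have : 0 <= (1 - g ord0) * (F - G) by apply: mulr_ge0; lra.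
lra.
Qed.

Lemma cauchy_diff_le y : cauchy_diff y <= 3 * sqnorm y.
Proof.
apply: (le_trans (prod_diff_le _ _)).
- move=> i; have /andP[/ltW -> _] /= := cauchy_factor_bounds (2 * y i).
  by apply: le_cauchy_factor; have := sqr_ge0 (y i); lra.
- by move=> i; have /andP[] := cauchy_factor_bounds (y i).
- rewrite /sqnorm mulr_sumr; apply: ler_sum => i _.
  have := sqr_ge0 (y i) => y0.
  have n1 : 1 + y i ^+ 2 != 0 by rewrite gt_eqF//; lra.
  have n2 : 1 + 4 * y i ^+ 2 != 0 by rewrite gt_eqF//; lra.
  have -> : (1 + y i ^+ 2)^-1 - (1 + (2 * y i) ^+ 2)^-1 =
      3 * y i ^+ 2 * ((1 + y i ^+ 2)^-1 * (1 + 4 * y i ^+ 2)^-1).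
    have -> : (2 * y i) ^+ 2 = 4 * y i ^+ 2 by ring.
    by field; rewrite n1 n2.
  have /andP[a0 a1] := cauchy_factor_bounds (y i).
  have /andP[] := cauchy_factor_bounds (2 * y i).
  have -> : (2 * y i) ^+ 2 = 4 * y i ^+ 2 by ring.
  move=> b0 b1; rewrite ler_piMr//; [lra|].
  by rewrite mulr_ile1// ltW.
Qed.

Hypothesis d_gt0 : (0 < d)%N.
Let dR_gt0 : 0 < d%:R :> R. Proof. by rewrite ltr0n. Qed.
Let dR_ge1 : 1 <= d%:R :> R. Proof. by rewrite ler1n. Qed.

Lemma sqnorm_le_max y : exists i, sqnorm y <= d%:R * y i ^+ 2.
Proof.
pose i0 := Ordinal d_gt0.
case: (@arg_maxP _ _ _ i0 xpredT (fun i => y i ^+ 2) erefl) => i _ hi.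
exists i; rewrite mulr_natl -[d in X in _ <= X]card_ord -sumr_const.
by apply: ler_sum => j _; exact: hi.
Qed.

Lemma coord_le_sqnorm y i : y i ^+ 2 <= sqnorm y.
Proof.
rewrite /sqnorm (bigD1 i)//= lerDl; apply: sumr_ge0 => j _; exact: sqr_ge0.
Qed.

(** Three losses on the unit ball: [2^-d] for [cauchy_prod], [3 / 5] for [3 / (1 + 4 y_i^2)], and
    [1 / d] for keeping only the largest coordinate. *)
Definition cauchy_small_cst : R := 5 / 3 * d%:R * 2 ^+ d.

Lemma cauchy_small_cst_gt0 : 0 < cauchy_small_cst.
Proof.
have dp := dR_gt0; have dp1 := dR_ge1. by rewrite /cauchy_small_cst mulr_gt0// ?exprn_gt0// mulr_gt0//; lra. Qed.

Lemma cauchy_diff_small y : sqnorm y <= 1 -> sqnorm y <= cauchy_small_cst * cauchy_diff y.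
Proof.
move=> y1; have [i hi] := sqnorm_le_max y.
have := coord_le_sqnorm y i => yi; have := sqr_ge0 (y i) => yi0.
have hS : (2 ^+ d)^-1 <= cauchy_prod y.
  have -> : (2 ^+ d)^-1 = \prod_(j < d) 2^-1 :> R.
    by rewrite prodr_const card_ord exprVn.
  apply: ler_prod => j _; apply/andP; split; first lra.
  have := coord_le_sqnorm y j; have := sqr_ge0 (y j) => ? ?.
  by rewrite lef_pV2 ?posrE; lra.
have h1 : 3 / 5 * y i ^+ 2 <= 3 * y i ^+ 2 / (1 + 4 * y i ^+ 2).
  rewrite ler_pdivlMr; last lra.
  have : 0 <= y i ^+ 2 * (1 - y i ^+ 2) by apply: mulr_ge0; lra.
  lra.
have h2 : (2 ^+ d)^-1 * (3 / 5 * y i ^+ 2) <= cauchy_diff y.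
  apply: le_trans (cauchy_diff_ge y i); apply: ler_pM; [|lra|exact: hS|exact: h1].
  by rewrite invr_ge0 exprn_ge0.
apply: (le_trans hi).
have := ler_wpM2l (ltW cauchy_small_cst_gt0) h2; apply: le_trans.
rewrite /cauchy_small_cst.
have n2 : 2 ^+ d != 0 :> R by rewrite expf_neq0.
move: (2 ^+ d) n2 (d%:R) => w n2 dd.
by rewrite le_eqVlt; apply/orP; left; apply/eqP; field.
Qed.

(** The largest coordinate satisfies [y_i^2 >= 1 / d], where the fraction in [cauchy_diff_ge] is at
    least [3 / (d + 4)]. *)
Lemma cauchy_diff_large y : 1 <= sqnorm y -> cauchy_prod y <= (d%:R + 4) / 3 * cauchy_diff y.
Proof.
have dp := dR_gt0; have dp1 := dR_ge1.
move=> y1; have [i hi] := sqnorm_le_max y.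
have yi : 1 <= d%:R * y i ^+ 2 by lra.
have yi0 := sqr_ge0 (y i).
have h1 : 3 / (d%:R + 4) <= 3 * y i ^+ 2 / (1 + 4 * y i ^+ 2).
  by rewrite ler_pdivlMr; [rewrite mulrAC ler_pdivrMr|]; lra.
have /andP[/ltW S0 _] := cauchy_prod_bounds y.
have h2 : cauchy_prod y * (3 / (d%:R + 4)) <= cauchy_diff y.
  by apply: le_trans (cauchy_diff_ge y i); apply: ler_wpM2l.
have c0 : 0 <= (d%:R + 4) / 3 :> R by lra.
have := ler_wpM2l c0 h2; apply: le_trans.
rewrite le_eqVlt; apply/orP; left; apply/eqP.
by field; rewrite gt_eqF//; lra.
Qed.

(** Only the largest coordinate is known to be of size [K], hence the gain of a single factor
    [K^-2]; the other factors merely increase when [y] is divided by [K]. *)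
Lemma cauchy_prod_scale (K : R) y : 1 <= K -> K ^+ 2 <= sqnorm y ->
  cauchy_prod y <= (d%:R + 1) / K ^+ 2 * cauchy_prod (fun i => y i / K).
Proof.
have dp := dR_gt0; have dp1 := dR_ge1.
move=> K1 Ky; have [i hi] := sqnorm_le_max y.
have K2 : 1 <= K ^+ 2 by rewrite exprn_ege1.
have yi : K ^+ 2 <= d%:R * y i ^+ 2 by lra.
rewrite /cauchy_prod (bigD1 i)//= [X in _ <= _ * X](bigD1 i)//=.
have sq z : (z / K) ^+ 2 = z ^+ 2 / K ^+ 2 by rewrite expr_div_n.
have h j : (y j / K) ^+ 2 <= y j ^+ 2.
  by rewrite sq ler_pdivrMr ?ler_peMr ?sqr_ge0//; lra.
have hp := @le_cauchy_factor_others _ _ i h.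
rewrite mulrA; apply: ler_pM => //.
- by have /andP[/ltW] := cauchy_factor_bounds (y i).
- by apply: prodr_ge0 => j _; have /andP[/ltW] := cauchy_factor_bounds (y j).
have yi0 := sqr_ge0 (y i).
have n1 : K ^+ 2 != 0 by rewrite gt_eqF//; lra.
have n2 : K ^+ 2 + y i ^+ 2 != 0 by rewrite gt_eqF//; lra.
have -> : (d%:R + 1) / K ^+ 2 * (1 + (y i / K) ^+ 2)^-1 = (d%:R + 1) / (K ^+ 2 + y i ^+ 2).
  have nK : K != 0 by rewrite gt_eqF//; lra.
  by rewrite sq; field; rewrite ?nK ?n1 ?n2.
by rewrite ler_pdivlMr; [rewrite mulrC ler_pdivrMr|]; lra.
Qed.

Definition cauchy_split_cst : R := 3 * cauchy_small_cst + (d%:R + 1) * (d%:R + 4) / 3.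

Lemma cauchy_split_cst_gt0 : 0 < cauchy_split_cst.
Proof.
have dp := dR_gt0; have dp1 := dR_ge1.
have := cauchy_small_cst_gt0; rewrite /cauchy_split_cst.
have : 0 < (d%:R + 1) * (d%:R + 4) :> R by apply: mulr_gt0; lra.
lra.
Qed.

(** Inside the ball of radius [1 / K] the quadratic upper bound at [y] is [K^-2] times the one at
    [K y], which still lies in the unit ball, where the kernel is at least quadratic. Outside the
    ball of radius [K] the decay of the product gains [K^-2] at [y / K], which still lies outside
    the unit ball, where the kernel controls the product. In between the kernel is at most 1. *)
Lemma cauchy_diff_split (K : R) y : 1 <= K ->
  cauchy_diff y <= cauchy_split_cst / K ^+ 2 *
      (cauchy_diff (fun i => K * y i) + cauchy_diff (fun i => y i / K))
    + ((K ^- 2 <= sqnorm y) && (sqnorm y <= K ^+ 2))%:R.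
Proof.
have dp := dR_gt0; have dp1 := dR_ge1.
move=> K1; have K2 : 1 <= K ^+ 2 by rewrite exprn_ege1.
have K20 : 0 < K ^+ 2 by lra.
have h1 := cauchy_diff_ge0 (fun i => K * y i) d_gt0.
have h2 := cauchy_diff_ge0 (fun i => y i / K) d_gt0.
have c1 := cauchy_small_cst_gt0.
have c2 : 0 < (d%:R + 1) * (d%:R + 4) / 3 :> R.
  by have : 0 < (d%:R + 1) * (d%:R + 4) :> R by apply: mulr_gt0; lra.
set A := cauchy_diff (fun i => K * y i) in h1 *.
set B := cauchy_diff (fun i => y i / K) in h2 *.
have [ys|ys] /= := lerP (K ^- 2) (sqnorm y).
  have [yl|yl] /= := lerP (sqnorm y) (K ^+ 2).
    have := cauchy_diff_le1 y.
    have : 0 <= cauchy_split_cst / K ^+ 2 * (A + B).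
      by apply: mulr_ge0; [rewrite divr_ge0 ?ltW ?cauchy_split_cst_gt0|lra].
    lra.
  rewrite addr0; have /= h3 := @cauchy_prod_scale K y K1 (ltW yl).
  have h4 : cauchy_prod (fun i => y i / K) <= (d%:R + 4) / 3 * B.
    apply: cauchy_diff_large; rewrite /sqnorm.
    under eq_bigr do rewrite expr_div_n.
    by rewrite -mulr_suml ler_pdivlMr// mul1r ltW.
  have /andP[/ltW S0 _] := cauchy_prod_bounds (fun i => 2 * y i).
  have h5 : cauchy_diff y <= (d%:R + 1) / K ^+ 2 * ((d%:R + 4) / 3 * B).
    apply: (@le_trans _ _ (cauchy_prod y)); first by rewrite /cauchy_diff; lra.
    apply: (le_trans h3); apply: ler_wpM2l => //; apply: divr_ge0; lra.
  apply: (le_trans h5).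
  have -> : (d%:R + 1) / K ^+ 2 * ((d%:R + 4) / 3 * B) =
    ((d%:R + 1) * (d%:R + 4) / 3) / K ^+ 2 * B by field; rewrite gt_eqF//; lra.
  apply: ler_pM => //; [by rewrite divr_ge0// ltW| |lra].
  by rewrite ler_pM2r ?invr_gt0// /cauchy_split_cst; lra.
rewrite addr0; have sqK : sqnorm (fun i => K * y i) = K ^+ 2 * sqnorm y.
  by rewrite /sqnorm mulr_sumr; apply: eq_bigr => i _; rewrite exprMn.
have h3 : sqnorm (fun i => K * y i) <= 1.
  by rewrite sqK mulrC -ler_pdivlMr// mul1r ltW.
have := cauchy_diff_small h3; rewrite -/A sqK => h4.
have h5 := cauchy_diff_le y.
have h6 : cauchy_diff y <= 3 * cauchy_small_cst / K ^+ 2 * A.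
  apply: (le_trans h5); rewrite mulrAC ler_pdivlMr//; lra.
apply: (le_trans h6); apply: ler_pM => //; [by rewrite divr_ge0//; lra| |lra].
by rewrite ler_pM2r ?invr_gt0// /cauchy_split_cst; lra.
Qed.

(** The box lies in the unit ball and [sqnorm] is at least [1 / (4 d)] on it, so [cauchy_diff_small]
    applies. *)
Lemma cauchy_diff_box y : (forall i, (2 * d%:R)^-1 <= y i <= d%:R^-1) ->
  (4 * d%:R * cauchy_small_cst)^-1 <= cauchy_diff y.
Proof.
have dp := dR_gt0; have dp1 := dR_ge1.
move=> yb.
have i1 : 0 < (2 * d%:R)^-1 :> R by rewrite invr_gt0; lra.
have h1 : sqnorm y <= 1.
  apply: (@le_trans _ _ (\sum_(i < d) d%:R^-1)).
    apply: ler_sum => i _; have /andP[a b] := yb i.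
    have : d%:R^-1 <= 1 :> R by rewrite invf_le1.
    rewrite expr2 => dd; apply: (@le_trans _ _ (1 * y i)); last lra.
    by rewrite ler_wpM2r//; lra.
  by rewrite sumr_const card_ord -[leLHS]mulr_natl mulfV// gt_eqF.
have h2 : (4 * d%:R)^-1 <= sqnorm y.
  apply: (@le_trans _ _ (\sum_(i < d) (2 * d%:R)^-1 ^+ 2)).
    rewrite sumr_const card_ord -[leRHS]mulr_natl le_eqVlt; apply/orP; left; apply/eqP.
    by field; rewrite gt_eqF.
  apply: ler_sum => i _; have /andP[a b] := yb i.
  by rewrite ler_sqr ?nnegrE//; lra.
have := cauchy_diff_small h1 => h3.
rewrite invfM ler_pdivrMr ?cauchy_small_cst_gt0//; lra.
Qed.

End kernel.

(** * Laplace variables *)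

Section density.
Context d (T : measurableType d) (R : realType).
Variables (mu nu : {measure set T -> \bar R}) (w : T -> R).
Hypothesis w0 : forall x, 0 <= w x.
Hypothesis mw : measurable_fun setT w.
Hypothesis nuE : forall A, measurable A -> nu A = (\int[mu]_(x in A) (w x)%:E)%E.

Import HBNNSimple.

Let integral_density_nnsfun (h : {nnsfun T >-> R}) :
  (\int[nu]_x (h x)%:E = \int[mu]_x ((h x)%:E * (w x)%:E))%E.
Proof.
rewrite integralT_nnsfun sintegralE.
have mh y : measurable (h @^-1` [set y]) by exact: measurable_sfunP.
transitivity (\int[mu]_x \sum_(y \in range h)
    (y * \1_(h @^-1` [set y]) x)%:E * (w x)%:E)%E; last first.
  apply: eq_integral => x _; rewrite -ge0_mule_fsuml.
    by rewrite fsumEFin// -fimfunE.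
  by move=> y; exact: nnfun_muleindic_ge0.
have mi y : measurable_fun setT (fun x => (\1_(h @^-1` [set y]) x : R)%:E).
  exact/measurable_EFinP/measurable_indic.
have mwE : measurable_fun setT (fun x => (w x)%:E) by exact/measurable_EFinP.
rewrite ge0_integral_fsum//.
- apply: eq_fsbigr => y; rewrite inE => -[t _ <-].
  under [RHS]eq_integral do rewrite EFinM -muleA.
  rewrite ge0_integralZl//.
  + rewrite nuE// integral_mkcond; congr (_ * _)%E; apply: eq_integral => x _.
    rewrite patchE indicE; case: ifPn => _; first by rewrite mul1e.
    by rewrite mul0e.
  + exact: emeasurable_funM.
  + by move=> x _; rewrite mule_ge0// ?lee_fin.
  + by rewrite lee_fin.
- move=> y; apply: emeasurable_funM => //; apply/measurable_EFinP.
  by apply: measurable_funM => //; exact: measurable_indic.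
- by move=> y x _; rewrite mule_ge0 ?nnfun_muleindic_ge0// lee_fin.
Qed.

(** Simple functions first, then monotone convergence on both sides. *)
Lemma ge0_integral_density (f : T -> R) : (forall x, 0 <= f x) -> measurable_fun setT f ->
  (\int[nu]_x (f x)%:E = \int[mu]_x (f x * w x)%:E)%E.
Proof.
move=> f0 mf; have mfE : measurable_fun setT (EFin \o f) by exact/measurable_EFinP.
pose h := nnsfun_approx measurableT mfE.
have hf x : (h n x)%:E @[n --> \oo] --> (f x)%:E.
  by apply: (cvg_nnsfun_approx measurableT mfE) => // y _; rewrite lee_fin.
have nd x : {homo (fun n => h n x) : m n / (m <= n)%N >-> m <= n}.
  by move=> m n mn; exact/lefP/nd_nnsfun_approx.
transitivity (limn (fun n => \int[nu]_x (h n x)%:E)%E).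
  rewrite -monotone_convergence//.
  - by apply: eq_integral => x _; apply/esym/cvg_lim => //; exact: hf.
  - by move=> n; exact/measurable_EFinP.
  - by move=> n x _; rewrite lee_fin.
  - by move=> x _ m n mn; rewrite lee_fin nd.
under eq_fun do rewrite integral_density_nnsfun.
rewrite -monotone_convergence//.
- apply: eq_integral => x _; rewrite EFinM; apply/cvg_lim => //.
  exact: cvgeZr.
- by move=> n; apply: emeasurable_funM; exact/measurable_EFinP.
- by move=> n x _; rewrite mule_ge0// lee_fin.
- by move=> x _ m n mn; rewrite lee_wpmul2r ?lee_fin ?nd.
Qed.

End density.

Section exponential_integrals.
Variable R : realType.
Local Notation mu := (@lebesgue_measure R).

(** The summand 1 makes the integrand nonnegative, as the form of the fundamental theorem on a
    half-line used here requires. The phase [c] will carry the contribution of other coordinates. *)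
Lemma integral_exp_cos (c x : R) :
  (\int[mu]_(z in `[0%R, +oo[) ((1 + cos (c + x * z)) * expR (- z))%:E =
   (1 + (cos c - x * sin c) / (1 + x ^+ 2))%:E)%E.
Proof.
(* The oscillating part is the real part of [exp (i c + (i x - 1) z) / (i x - 1)]. *)
pose F z := - expR (- z) * (1 + (cos (c + x * z) - x * sin (c + x * z)) / (1 + x ^+ 2)).
have x2 : 1 + x ^+ 2 != 0 by rewrite gt_eqF//; have := sqr_ge0 x; lra.
have dF z : is_derive z (1:R) F ((1 + cos (c + x * z)) * expR (- z)).
  rewrite /F; apply: is_derive_eq.
  rewrite /GRing.scale /=; field.
  exact: x2.
have e0 : expR (- z) @[z --> +oo] --> (0 : R) by exact: cvgr_expR.
pose C := 1 + (1 + `|x|) / (1 + x ^+ 2).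
have Fle z : `|F z| <= C * expR (- z).
  rewrite /F normrM normrN (gtr0_norm (expR_gt0 _)) mulrC ler_pM2r ?expR_gt0//.
  apply: (le_trans (ler_normD _ _)); rewrite normr1 lerD2l.
  have x20 : 0 < 1 + x ^+ 2 by have := sqr_ge0 x; lra.
  rewrite normrM normfV (gtr0_norm x20) ler_pM2r ?invr_gt0//.
  apply: (le_trans (ler_normB _ _)); rewrite lerD//.
    by rewrite ler_norml cos_geN1 cos_le1.
  by rewrite normrM ler_piMr// ler_norml sin_geN1 sin_le1.
rewrite (@ge0_continuous_FTC2y _ _ F 0 0).
- rewrite /F oppr0 expR0 mulr0 addr0 sub0e -EFinN; congr EFin; ring.
- move=> z _; apply: mulr_ge0; last exact: expR_ge0.
  by have := cos_geN1 (c + x * z); lra.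
- apply: continuous_subspaceT => z; apply: differentiable_continuous.
  exact/derivable1_diffP/ex_derive.
- apply/cvgr0Pnorm_le => /= e e_gt0.
  have C0 : 0 < C.
    have x20 : 0 < 1 + x ^+ 2 by have := sqr_ge0 x; lra.
    by apply: ltr_wpDr => //; rewrite divr_ge0 ?ltW//; have := normr_ge0 x; lra.
  have /cvgr0Pnorm_le /(_ (e / C)) := e0.
  rewrite divr_gt0// => /(_ erefl); apply: filterS => z.
  rewrite (gtr0_norm (expR_gt0 _)) ler_pdivlMr// => h.
  by apply: (le_trans (Fle _)); rewrite mulrC.
- by move=> z _; have [] := dF z.
- apply: cvg_at_right_filter.
  have /derivable1_diffP/differentiable_continuous : derivable F 0 1 by have [] := dF 0.
  exact.
- by move=> z _; rewrite derive1E; have [_ ->] := dF z.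
Qed.

Lemma integral_powRV : (\int[mu]_(x in `]0%R, 1%R]) (x `^ (- (1 / 2)))%:E <= 2%:E)%E.
Proof.
(* With [n.+2] the left endpoint is below 1 already for [n = 0], so the intervals are never
   degenerate. *)
pose I_ n : set R := `[(n.+2%:R : R)^-1, 1%R]%classic.
have -> : `]0%R, 1%R]%classic = \bigcup_n I_ n.
  apply/seteqP; split => x /=; rewrite in_itv/=.
    move=> /andP[x0 x1]; exists (Num.bound x^-1) => //; rewrite /I_/= in_itv/= x1 andbT.
    rewrite -[leRHS]invrK lef_pV2 ?posrE ?invr_gt0//.
    apply/ltW/(lt_le_trans (archi_boundP _)); first by rewrite invr_ge0 ltW.
    by rewrite ler_nat; apply/leqW/leqW.
  move=> [n _]; rewrite /I_/= in_itv/= => /andP[nx ->]; rewrite andbT.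
  by apply: lt_le_trans nx; rewrite invr_gt0.
have mf (A : set R) : measurable_fun A (fun x : R => (x `^ (- (1 / 2)))%:E).
  by apply: measurable_funTS; apply/measurable_EFinP; exact: measurable_powR.
have ndI : nondecreasing_seq I_.
  move=> m n mn; apply/subsetPset => x; rewrite /I_/= !in_itv/= => /andP[h ->].
  by rewrite andbT (le_trans _ h)// lef_pV2 ?posrE// ler_nat !ltnS.
have f0 (x : R) : (0 <= (x `^ (- (1 / 2)))%:E)%E by rewrite lee_fin powR_ge0.
have hcvg : (\int[mu]_(x in I_ n) (x `^ (- (1 / 2)))%:E @[n --> \oo] -->
    \int[mu]_(x in \bigcup_n I_ n) (x `^ (- (1 / 2)))%:E)%E.
  apply: ge0_nondecreasing_set_cvg_integral.
  - exact: ndI.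
  - by move=> i; exact: measurable_itv.
  - by move=> i; exact: mf.
  - by move=> i x _; exact: f0.
rewrite -(cvg_lim _ hcvg)//; apply: lime_le; first by apply/cvg_ex; eexists; exact: hcvg.
apply: nearW => n.
have n1 : (n.+2%:R : R)^-1 < 1 by rewrite invf_lt1// ltr1n.
have n0 : 0 < (n.+2%:R : R)^-1 by rewrite invr_gt0.
have dF (z : R) : 0 < z -> is_derive z (1:R) (fun z => 2 * z `^ (1 / 2)) (z `^ (- (1 / 2))).
  move=> z0; have h := is_derive1_powR (1 / 2) z0.
  have -> : - (1 / 2) = 1 / 2 - 1 :> R by lra.
  by apply: is_derive_eq; rewrite /GRing.scale/= ?mulr0 ?add0r; field.
have cF (z : R) : 0 < z -> {for z, continuous (fun z => 2 * z `^ (1 / 2))}.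
  by move=> z0; apply/differentiable_continuous/derivable1_diffP; have [] := dF z z0.
rewrite (@continuous_FTC2 _ _ (fun z => 2 * z `^ (1 / 2)) _ _ n1).
- by rewrite powR1 -EFinB lee_fin; have := powR_ge0 (n.+2%:R^-1 : R) (1 / 2); lra.
- apply: continuous_in_subspaceT => z; rewrite inE/= in_itv/= => /andP[nz _].
  apply/differentiable_continuous/derivable1_diffP.
  by have [] := is_derive1_powR (- (1 / 2)) (lt_le_trans n0 nz).
- split.
  + move=> z; rewrite in_itv/= => /andP[nz _].
    by have [] := dF z (lt_trans n0 nz).
  + by apply: cvg_at_right_filter; exact: cF.
  + by apply: cvg_at_left_filter; exact: cF.
- move=> z; rewrite in_itv/= => /andP[nz _]; rewrite derive1E.
  by have [_ ->] := dF z (lt_trans n0 nz).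
Qed.

Definition exponential1 :=
  exponential_distribution_exponential_prob__canonical__probability_measure_Probability (@ltr01 R).

Lemma integral_exponential1 (f : R -> R) : (forall x, 0 <= f x) -> measurable_fun setT f ->
  (\int[exponential1]_x (f x)%:E = \int[mu]_(x in `[0%R, +oo[) (f x * expR (- x))%:E)%E.
Proof.
move=> f0 mf.
rewrite (@ge0_integral_density _ _ _ mu exponential1 (exponential_pdf 1))//.
- rewrite [RHS]integral_mkcond; apply: eq_integral => x _.
  rewrite /exponential_pdf !patchE; case: ifPn => _; last by rewrite mulr0.
  by rewrite mul1r mulN1r.
- by move=> x; apply: exponential_pdf_ge0.
- exact: measurable_exponential_pdf.
Qed.

Lemma half01 : 0 <= (1 / 2 : R) <= 1. Proof. by apply/andP; split; lra. Qed.

Definition fair_coin := @bernoulli_prob R (1 / 2).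

(** The law of a standard exponential variable multiplied by an independent fair sign. *)
Lemma laplace_law : exists m : probability R R, forall f : R -> R,
  (forall x, 0 <= f x) -> measurable_fun setT f ->
  (\int[m]_x (f x)%:E = (1 / 2)%:E * \int[exponential1]_x (f x)%:E +
     (1 / 2)%:E * \int[exponential1]_x (f (- x))%:E)%E.
Proof.
pose g (z : measurableTypeR R * bool) : R := if z.2 then z.1 else - z.1.
have mg : measurable_fun setT g.
  apply: (measurable_fun_if_pair (x := fun x : measurableTypeR R => x : R) (y := fun x : measurableTypeR R => - x : R)).
    exact: measurable_id.
  exact: oppr_measurable.
pose G : {mfun (measurableTypeR R * bool)%type >-> R} := HB.pack g (isMeasurableFun.Build _ _ _ _ g mg).
exists (distribution (exponential1 \x fair_coin)%E G) => f f0 mf.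
have mfE : measurable_fun setT (fun x => (f x)%:E) by exact/measurable_EFinP.
have mfg : measurable_fun setT (fun z => (f (g z))%:E).
  exact: measurableT_comp mfE mg.
rewrite ge0_integral_distribution//= fubini_tonelli2//=.
rewrite /fubini_G (integral_bernoulli_prob half01)/=; last first.
  by move=> b; apply: integral_ge0 => [//|x _]; rewrite lee_fin.
by congr (_ + _ * _)%E; congr EFin; apply: (@eq_trans _ _ (1 - 1 / 2)) => //; lra.
by move=> x; rewrite lee_fin.
Qed.

Lemma prob_bounded_integrable d (T : measurableType d) (P : probability T R) (f : T -> R) (C : R) :
  measurable_fun setT f -> (forall x, `|f x| <= C) -> P.-integrable setT (EFin \o f).
Proof.
move=> mf fC; apply: measurable_bounded_integrable; [by []| |exact: mf|].
  exact: (le_lt_trans (probability_le1 P measurableT) (ltry _)).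
by exists C; split; [exact: num_real|move=> M CM x _; exact: le_trans (ltW CM)].
Qed.

Lemma integral_exponential1_weight :
  (\int[exponential1]_z (`|z| `^ (- (1 / 2)) + expR (`|z| / 2))%:E < +oo)%E.
Proof.
have mpow : measurable_fun setT (fun z : R => `|z| `^ (- (1 / 2))).
  exact: (measurableT_comp (@measurable_powR R _) (@normr_measurable R setT)).
have mexp : measurable_fun setT (fun z : R => expR (`|z| / 2)).
  apply: (measurableT_comp (@measurable_expR R)).
  by apply: measurable_funM => //; exact: normr_measurable.
rewrite integral_exponential1; last 2 first.
- by move=> x; rewrite addr_ge0 ?powR_ge0 ?expR_ge0.
- exact: measurable_funD.
pose a : R -> \bar R := (fun x : R => (x `^ (- (1 / 2)))%:E) \_ `]0%R, 1%R].
(* On the half-line [b x = 2 exp (- x / 2)]: one copy for the exponential part of the weight, the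
   other for the power part beyond 1, where it is at most 1. The singularity at 0 goes into [a]. *)
pose b : R -> \bar R := fun x => (4 * exponential_pdf (1 / 2) x)%:E.
have a0 x : (0 <= a x)%E by apply: erestrict_ge0 => y _; rewrite lee_fin powR_ge0.
have b0 x : (0 <= b x)%E.
  by rewrite lee_fin mulr_ge0 ?exponential_pdf_ge0//; lra.
have ma : measurable_fun [set: measurableTypeR R] a.
  apply/(measurable_restrictT _ _).1 => //.
  by apply: measurable_funTS; apply/measurable_EFinP; exact: measurable_powR.
have mb : measurable_fun [set: measurableTypeR R] b.
  apply/measurable_EFinP; apply: measurable_funM => //.
  exact: measurable_exponential_pdf.
apply: (@le_lt_trans _ _ (\int[mu]_(x in `[0%R, +oo[) (a x + b x))%E).
  apply: ge0_le_integral; first exact: measurable_itv.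
  - by move=> x _; rewrite lee_fin mulr_ge0 ?addr_ge0 ?powR_ge0 ?expR_ge0.
  - apply: measurable_funTS; apply/measurable_EFinP; apply: measurable_funM.
      exact: measurable_funD.
    exact: (measurableT_comp (@measurable_expR R) (@oppr_measurable R _)).
  - by apply: measurable_funTS; exact: emeasurable_funD.
  - move=> x /=; rewrite in_itv/= andbT => x0.
    rewrite ger0_norm//.
    have e1 : expR (x / 2) * expR (- x) = expR (- (1 / 2) * x).
      by rewrite -expRD; congr expR; lra.
    have -> : b x = (2 * expR (- (1 / 2) * x))%:E.
      by rewrite /b exponential_pdfE//; congr EFin; field.
    have e2 : expR (- x) <= expR (- (1 / 2) * x) by rewrite ler_expR; lra.
    have e3 := expR_gt0 (- (1 / 2) * x).
    rewrite mulrDl e1 /a patchE; case: ifPn.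
      rewrite inE/= in_itv/= => _; rewrite -EFinD lee_fin.
      have : x `^ (- (1 / 2)) * expR (- x) <= x `^ (- (1 / 2)).
        by rewrite ler_piMr ?powR_ge0// -expR0 ler_expR oppr_le0.
      lra.
    rewrite notin_setE/= in_itv/= => /negP xn; rewrite add0e lee_fin.
    have : x `^ (- (1 / 2)) <= 1.
      (* The power function takes the value 0 at base 0 for a nonzero exponent; the origin lies
         outside the support of [a] and is therefore treated here. *)
      have [->|xn0] := eqVneq x 0.
        by rewrite powR0 ?ler01// oppr_eq0 gt_eqF//; lra.
      have x00 : 0 < x by rewrite lt_neqAle eq_sym xn0.
      have x1 : 1 < x by rewrite ltNge; apply: contra xn; rewrite x00.
      rewrite powRN invf_le1 ?powR_gt0//.
      have := @ge0_ler_powR R (1 / 2) ltac:(lra) 1 x.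
      by rewrite !nnegrE powR1 ler01 x0 (ltW x1) => /(_ erefl erefl erefl).
    have := powR_ge0 x (- (1 / 2)); have := expR_gt0 (- x).
    nra.
rewrite ge0_integralD//=; [|exact: measurable_funTS|exact: measurable_funTS].
apply: lte_add_pinfty.
  apply: (@le_lt_trans _ _ (\int[mu]_x a x)%E).
    by apply: ge0_subset_integral.
  rewrite /a -integral_mkcond; apply: le_lt_trans integral_powRV _; exact: ltry.
apply: (@le_lt_trans _ _ (\int[mu]_x b x)%E); first exact: ge0_subset_integral.
rewrite /b; under eq_integral do rewrite EFinM.
rewrite ge0_integralZl//=.
- rewrite integral_exponential_pdf ?mule1 ?ltry//; lra.
- by apply/measurable_EFinP; exact: measurable_exponential_pdf.
- by move=> x _; rewrite lee_fin exponential_pdf_ge0//; lra.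
Qed.

Lemma integral_exponential1_itv : (0 < \int[exponential1]_z (\1_(`[1%R, 2%R]) z : R)%:E)%E.
Proof.
rewrite integral_exponential1//.
apply: (@lt_le_trans _ _ (\int[mu]_(x in `[0%R, +oo[) ((expR (- 2))%:E * (\1_(`[1%R, 2%R]) x)%:E))%E).
  rewrite ge0_integralZl//=.
  - rewrite mule_gt0// ?lte_fin ?expR_gt0// integral_indic//=.
    rewrite (_ : `[1%R, 2%R] `&` `[0%R, +oo[ = `[1%R, 2%R]).
      by rewrite lebesgue_measure_itv/= lte_fin ltr1n/= -EFinB lte_fin; lra.
    apply/seteqP; split => x/=; first by case.
    by rewrite !in_itv/= => h; split => //; rewrite andbT; lra.
  - by apply/measurable_EFinP.
apply: ge0_le_integral; first exact: measurable_itv.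
- by move=> x _; rewrite mule_ge0// lee_fin.
- apply: emeasurable_funM => //; exact/measurable_EFinP.
- apply/measurable_EFinP; apply: measurable_funM => //.
  apply: measurable_funTS.
  exact: (measurableT_comp (@measurable_expR R) (@oppr_measurable R _)).
- move=> x _; rewrite -EFinM lee_fin mulrC indicE; case: (boolP (x \in _)) => /=.
    by rewrite inE/= in_itv/= => /andP[_ x2]; rewrite !mul1r ler_expR lerN2.
  by rewrite !mul0r.
Qed.

(** Averaging over the sign kills the odd term [x sin c] and leaves [cos c / (1 + x^2)]. The finite
    weight controls small and large values of the variable; the mass of [[1, 2]] feeds the lower
    bound. *)
Lemma cauchy_law : exists m : probability R R,
  [/\ (forall c x : R, (\int[m]_z (cos (c + x * z))%:E = (cos c * (1 + x ^+ 2)^-1)%:E)%E),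
      (\int[m]_z (`|z| `^ (- (1 / 2)) + expR (`|z| / 2))%:E < +oo)%E &
      (0 < \int[m]_z (\1_(`[1%R, 2%R]) z : R)%:E)%E].
Proof.
have [m mE] := laplace_law; exists m; split.
- move=> c x.
  have mc : measurable_fun setT (fun z : R => cos (c + x * z)).
    apply: (measurableT_comp (continuous_measurable_fun (@continuous_cos R))).
    by apply: measurable_funD => //; apply: measurable_funM.
  have m1c : measurable_fun setT (fun z : R => 1 + cos (c + x * z)) by exact: measurable_funD.
  have c0 z : 0 <= 1 + cos (c + x * z) by have := cos_geN1 (c + x * z); lra.
  have icos : m.-integrable setT (fun z => (cos (c + x * z))%:E).
    by apply: (@prob_bounded_integrable _ _ m _ 1) => // z; rewrite ler_norml cos_geN1 cos_le1.
  have : (\int[m]_z (1 + cos (c + x * z))%:E = (1 + cos c * (1 + x ^+ 2)^-1)%:E)%E.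
    rewrite mE// !integral_exponential1//; last first.
      by apply: measurableT_comp m1c _; exact: oppr_measurable.
    have := integral_exp_cos c (- x).
    under eq_integral do rewrite mulNr -mulrN.
    move=> ->; rewrite integral_exp_cos -!EFinM -EFinD; congr EFin.
    have x20 : 1 + x ^+ 2 != 0 by rewrite gt_eqF//; have := sqr_ge0 x; lra.
    by rewrite sqrrN; field.
  under eq_integral do rewrite EFinD.
  rewrite integralD//; last exact: finite_measure_integrable_cst.
  rewrite integral_cst// mul1e [X in (X + _)%E](_ : _ = 1%E); last exact: probability_setT.
  have := integrable_fin_num measurableT icos.
  by case: (\int[m]_z _)%E => // r _; rewrite -EFinD => -[/addrI ->].
- rewrite mE; last 2 first.
  + by move=> z; rewrite addr_ge0 ?powR_ge0 ?expR_ge0.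
  + apply: measurable_funD.
      exact: (measurableT_comp (@measurable_powR R _) (@normr_measurable R setT)).
    apply: (measurableT_comp (@measurable_expR R)).
    by apply: measurable_funM => //; exact: normr_measurable.
  under [X in (_ + _ * X)%E]eq_integral do rewrite normrN.
  have hw := integral_exponential1_weight.
  have h0 : (0 <= (1 / 2)%:E :> \bar R)%E by rewrite lee_fin; lra.
  by apply: lte_add_pinfty; apply: lte_mul_pinfty.
- rewrite mE//.
  have h0 : (0 < (1 / 2)%:E :> \bar R)%E by rewrite lte_fin; lra.
  apply: (lt_le_trans (mule_gt0 h0 integral_exponential1_itv)); apply: leeDl.
  by apply: mule_ge0; [exact: ltW|apply: integral_ge0 => z _; rewrite lee_fin].
Qed.

End exponential_integrals.

(** * Joint law of independent coordinates *)

Section tuple_law.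
Variable R : realType.

Lemma measurable_cos_lin n (c : R) (y : 'I_n -> R) :
  measurable_fun setT (fun z : n.-tuple R => cos (c + \sum_(i < n) tnth z i * y i)).
Proof.
apply: (measurableT_comp (continuous_measurable_fun (@continuous_cos R))).
apply: measurable_funD => //; apply: measurable_sum => i.
by apply: measurable_funM => //; exact: measurable_tnth.
Qed.

Lemma measurable_prod_coord n (h : R -> R) : measurable_fun setT h ->
  measurable_fun setT (fun z : n.-tuple R => \prod_(i < n) h (tnth z i)).
Proof.
move=> mh; apply: measurable_prod => i _.
by apply: measurableT_comp mh _; exact: measurable_tnth.
Qed.

(** Built one coordinate at a time as the image of a product measure. The free phase [c] closes the
    induction: once the first coordinate [x] is fixed, [x * y ord0] joins the phase. *)
Lemma tuple_law (m : probability R R) n : exists Q : probability (n.-tuple R) R,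
 (forall h : R -> R, (forall x, 0 <= h x) -> measurable_fun setT h ->
   (\int[Q]_z (\prod_(i < n) h (tnth z i))%:E = (\int[m]_x (h x)%:E) ^+ n)%E) /\
 (forall k : R -> R, (forall c x : R, (\int[m]_z (cos (c + x * z))%:E = (cos c * k x)%:E)%E) ->
   forall c (y : 'I_n -> R),
   (\int[Q]_z (cos (c + \sum_(i < n) tnth z i * y i))%:E = (cos c * \prod_(i < n) k (y i))%:E)%E).
Proof.
elim: n => [|n [Q [IH1 IH2]]].
  exists (dirac [tuple]); split.
    move=> h h0 mh; rewrite integral_dirac//; last first.
      by apply/measurable_EFinP; exact: measurable_prod_coord.
    by rewrite diracT mul1e big_ord0 expe0.
  move=> k hk c y; rewrite integral_dirac//; last first.
    by apply/measurable_EFinP; exact: measurable_cos_lin.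
  by rewrite diracT mul1e !big_ord0 addr0 mulr1.
pose g (z : R * n.-tuple R) : n.+1.-tuple R := [tuple of z.1 :: z.2].
have mg : measurable_fun setT g by apply: measurable_cons.
pose G : {mfun (R * n.-tuple R)%type >-> n.+1.-tuple R} :=
  HB.pack g (isMeasurableFun.Build _ _ _ _ g mg).
exists (distribution (m \x Q)%E G); split.
  move=> h h0 mh; rewrite expeS -IH1//.
  have mp := @measurable_prod_coord n.+1 h mh.
  have mpn := @measurable_prod_coord n h mh.
  have p0 k (z : k.-tuple R) : 0 <= \prod_(i < k) h (tnth z i) by apply: prodr_ge0.
  rewrite ge0_integral_distribution; last 2 first.
  - by apply/measurable_EFinP.
  - by move=> z; rewrite lee_fin.
  have mpg : measurable_fun setT (fun z => (\prod_(i < n.+1) h (tnth (g z) i))%:E).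
    by apply/measurable_EFinP; exact: measurableT_comp mp mg.
  rewrite fubini_tonelli1//= /fubini_F.
  transitivity (\int[m]_x ((h x)%:E * \int[Q]_z (\prod_(i < n) h (tnth z i))%:E))%E.
    apply: eq_integral => x _; rewrite -ge0_integralZl//; last 3 first.
    - exact/measurable_EFinP.
    - by move=> z _; rewrite lee_fin.
    - by rewrite lee_fin.
    apply: eq_integral => z _; rewrite -EFinM; congr EFin; rewrite /= big_ord_recl tnth0.
    by congr (_ * _); apply: eq_bigr => i _; rewrite tnthS.
  rewrite ge0_integralZr//.
  - exact/measurable_EFinP.
  - by move=> x _; rewrite lee_fin.
  - by apply: integral_ge0 => z _; rewrite lee_fin.
  - by move=> z; rewrite lee_fin; exact: (p0 _ (g z)).
move=> k hk c y.
have mc := @measurable_cos_lin n.+1 c y.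
have mcg : measurable_fun setT (fun z => cos (c + \sum_(i < n.+1) tnth (g z) i * y i)).
  exact: measurableT_comp mc mg.
have icg := @prob_bounded_integrable R _ _ (m \x Q)%E _ 1 mcg.
have {}icg : ((m \x Q)%E).-integrable setT (fun z => (cos (c + \sum_(i < n.+1) tnth (g z) i * y i))%:E).
  by apply: icg => z; rewrite ler_norml cos_geN1 cos_le1.
rewrite integral_distribution//=; last exact/measurable_EFinP.
rewrite -integral12_prod_meas1//= /fubini_F.
transitivity (\int[m]_x ((cos (c + x * y ord0))%:E * (\prod_(i < n) k (y (lift ord0 i)))%:E))%E.
  apply: eq_integral => x _; rewrite -EFinM -(IH2 k hk).
  apply: eq_integral => z _; congr (cos _)%:E; rewrite /= big_ord_recl tnth0 addrA.
  by congr (_ + _); apply: eq_bigr => i _; rewrite tnthS.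
rewrite integralZr//.
  under eq_integral do rewrite mulrC.
  by rewrite hk -EFinM big_ord_recl mulrA.
apply: (@prob_bounded_integrable R _ _ m _ 1).
  apply: (measurableT_comp (continuous_measurable_fun (@continuous_cos R))).
  by apply: measurable_funD => //; apply: measurable_funM.
by move=> x; rewrite ler_norml cos_geN1 cos_le1.
Qed.

End tuple_law.

(** * Bounds on the exponent *)

Section exponent_bounds.
Variable R : realType.
Implicit Types l psi : R -> R.

(** What is retained of slow variation above the threshold [A], with a single constant for all
    clauses. The Potter rate 1/8 and the later condition [t * C <= 1 / 8] add up to the power 1/4 in
    the comparison of profiles. *)
Definition tame_exponent l psi (A C : R) :=
  [/\ 1 <= A, 1 <= C,
      (forall y, A <= y -> 0 < l y /\ l y <= C * (psi (2 * y) - psi y) <= C * (C * l y)),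
      (forall x v, A <= x -> 0 <= v ->
         l x <= C * expR (v / 8) * l (x * expR v) /\ l (x * expR v) <= C * expR (v / 8) * l x) &
      (forall x v, A <= x -> 0 <= v -> - C <= psi (x * expR v) - psi x <= C * (1 + v))].

Lemma near_pinfty_expR (Q : R -> Prop) : (\forall x \near +oo, Q x) ->
  exists N : R, forall s, N <= s -> Q (expR s).
Proof.
move=> [N [_ HN]]; exists N => s Ns; apply: HN.
by have := expR_ge1Dx s; lra.
Qed.

Lemma tame_exponentP l psi : slowly_varying_inf l ->
  (exists a M : R, forall x, a <= x -> l x <= M) -> Pi_inf l psi ->
  continuous (fun s => psi (expR s)) -> exists A C, tame_exponent l psi A C.
Proof.
move=> [a1 [lpos lsv]] [a2 [M lM]] [a3 [_ lPi]] cpsi.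
pose a := Num.max 0 (Num.max a1 a2).
have ea s : a <= s -> a1 <= expR s /\ a2 <= expR s.
  by rewrite !ge_max => /and3P[s0 s1 s2]; have := expR_ge1Dx s; split; lra.
pose F s := psi (expR s); pose G s := l (expR s).
have Gpos s : a <= s -> 0 < G s by move=> /ea[/lpos].
have GM s : a <= s -> G s <= M by move=> /ea[_ /lM].
have HF v e : 0 < e -> exists N : R, forall s, N <= s -> `|F (s + v) - F s - v * G s| <= e * G s.
  move=> e0; have /cvgrPdist_le /(_ e e0) := lPi _ (expR_gt0 v).
  move=> /near_pinfty_expR[N HN]; exists (Num.max a N) => s; rewrite ge_max => /andP[sa /HN].
  rewrite expRK -expRD (addrC v s) -/(F _) -/(F s) -/(G s) => h; have G0 := Gpos _ sa.
  rewrite -ler_pdivrMr// -[X in _ / X](gtr0_norm G0) -normfV -normrM mulrBl mulfK ?gt_eqF//.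
  by rewrite distrC.
have HG v e : 0 < e -> exists N : R, forall s, N <= s -> `|G (s + v) - G s| <= e * G s.
  move=> e0; have /cvgrPdist_le /(_ e e0) := lsv _ (expR_gt0 v).
  move=> /near_pinfty_expR[N HN]; exists (Num.max a N) => s; rewrite ge_max => /andP[sa /HN].
  rewrite -expRD (addrC v s) -/(G _) -/(G s) => h; have G0 := Gpos _ sa.
  rewrite -ler_pdivrMr// -[X in _ / X](gtr0_norm G0) -normfV -normrM mulrBl mulfV ?gt_eqF//.
  by rewrite distrC.
have [C1 [N1 [C10 H1]]] := potter_bound cpsi Gpos HF HG (divr_gt0 ltr01 (ltr0n R 8)).
have [C2 [N2 [C20 H2]]] := increment_growth cpsi Gpos GM HF HG.
have ln20 : 0 < ln 2 :> R by rewrite ln_gt0//; lra.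
(* The tolerance is half of the limiting ratio [ln 2], so the increment over a doubling stays
   comparable to [G s] from both sides. *)
have [N3 H3] := HF (ln 2) (ln 2 / 2) ltac:(lra).
pose C := 1 + C1 + C2 + 2 / ln 2 + 2 * ln 2.
have il : 0 < 2 / ln 2 :> R by rewrite divr_gt0.
have il2 : 2 / ln 2 * ln 2 = 2 :> R by rewrite divfK// gt_eqF.
pose N := Num.max (Num.max a N1) (Num.max N2 N3).
exists (expR N), C.
have e0 : 0 <= N by rewrite !le_max lexx.
have A0 x : expR N <= x -> exists2 s, x = expR s & [/\ a <= s, N1 <= s, N2 <= s & N3 <= s].
  move=> Nx; have x0 : 0 < x by apply: lt_le_trans Nx; exact: expR_gt0.
  exists (ln x); first by rewrite lnK.
  have : N <= ln x by rewrite -ler_expR lnK.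
  by rewrite !ge_max => /andP[/andP[-> ->] /andP[-> ->]].
split.
- by have := expR_ge1Dx N; lra.
- by rewrite /C; lra.
- move=> y /A0[s -> [sa _ _ s3]].
  have G0 := Gpos _ sa; split => //.
  have := H3 _ s3; rewrite ler_norml => /andP[h1 h2].
  have -> : 2 * expR s = expR (s + ln 2) by rewrite expRD lnK 1?mulrC// posrE.
  rewrite -/(F _) -/(F s) -/(G s).
  set D := F (s + ln 2) - F s in h1 h2 *.
  have D0 : ln 2 / 2 * G s <= D by lra.
  have D1 : D <= 2 * ln 2 * G s by lra.
  have Cp : 2 / ln 2 <= C by rewrite /C; lra.
  have Cp2 : 2 * ln 2 <= C by rewrite /C; lra.
  have Dp : 0 <= D by apply: le_trans D0; rewrite mulr_ge0//; lra.
  apply/andP; split.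
    have : 2 / ln 2 * D <= C * D by rewrite ler_wpM2r.
    have : 2 / ln 2 * (ln 2 / 2 * G s) <= 2 / ln 2 * D by rewrite ler_wpM2l//; lra.
    have -> : 2 / ln 2 * (ln 2 / 2 * G s) = G s by field; rewrite gt_eqF.
    lra.
  rewrite ler_wpM2l//; first by rewrite /C; lra.
  apply: (le_trans D1); rewrite ler_wpM2r//; lra.
- move=> x v /A0[s -> [sa s1 _ _]] v0.
  have [h1 h2] := H1 s (s + v) s1 ltac:(lra).
  rewrite -expRD -/(G s) -/(G (s + v)).
  have Cp : C1 <= C by rewrite /C; lra.
  have e8 : 1 / 8 * (s + v - s) = v / 8 by lra.
  rewrite e8 in h1 h2.
  have G0 := Gpos _ sa; have G1 : 0 < G (s + v) by apply: Gpos; lra.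
  split; [apply: (le_trans h1)|apply: (le_trans h2)];
    by rewrite ler_pM2r// ler_pM2r// expR_gt0.
- move=> x v /A0[s -> [_ _ s2 _]] v0.
  have := H2 s (s + v) s2 ltac:(lra).
  rewrite -expRD -/(F s) -/(F (s + v)) => /andP[h1 h2].
  have Cp : C2 <= C by rewrite /C; lra.
  apply/andP; split; first lra.
  apply: (le_trans h2); have -> : s + v - s = v by lra.
  by rewrite ler_wpM2r//; lra.
Qed.

(** Two uses of [1 + u <= exp u]. No order between [x] and [y] is assumed, since the increment of
    [psi] may be negative at low frequencies. *)
Lemma expR_diff_bounds (t x y : R) :
  t * (y - x) * expR (- (t * y)) <= expR (- (t * x)) - expR (- (t * y)) <=
  t * (y - x) * expR (- (t * x)).
Proof.
have e0 z : 0 < expR z := expR_gt0 z.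
have h1 : expR (- (t * y)) * (1 + t * (y - x)) <= expR (- (t * x)).
  have -> : - (t * x) = - (t * y) + t * (y - x) by ring.
  by rewrite expRD; apply: ler_wpM2l; [exact: expR_ge0|exact: expR_ge1Dx].
have h2 : expR (- (t * x)) * (1 + - (t * (y - x))) <= expR (- (t * y)).
  have -> : - (t * y) = - (t * x) + - (t * (y - x)) by ring.
  by rewrite expRD; apply: ler_wpM2l; [exact: expR_ge0|exact: expR_ge1Dx].
by apply/andP; split; lra.
Qed.

Variables (l psi : R -> R) (A C B : R).
Hypothesis tame : tame_exponent l psi A C.
Hypothesis psi0 : forall u, 0 <= u -> 0 <= psi u.
Hypothesis psiB : forall u, 0 <= u -> u <= 2 * A -> psi u <= B.

Local Notation L t x := (l x * expR (- (t * psi x))).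

Lemma profile_gt0 (t x : R) : A <= x -> 0 < L t x.
Proof. by case: tame => _ _ h _ _ /h[lx _]; rewrite mulr_gt0// expR_gt0. Qed.

(** Potter costs [exp (|v| / 8)]. Moving up, [psi] drops by at most [C]; moving down, by at most
    [C * (1 + |v|)]. After multiplication by [t] this costs at most another
    [exp ((1 + |v|) / 8)]. *)
Lemma profile_compare (t x v : R) : 0 <= t -> t * C <= 1 / 8 -> A <= x -> A <= x * expR v ->
  L t (x * expR v) <= C * expR (1 + `|v| / 4) * L t x.
Proof.
case: tame => A1 C1 h1 h2 h3 t0 tC xA yA.
have [lx _] := h1 _ xA; have [ly _] := h1 _ yA.
have C0 : 0 < C by lra.
have [v0|v0] := lerP 0 v.
  have [_ h] := h2 _ _ xA v0; have /andP[g _] := h3 _ _ xA v0.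
  rewrite ger0_norm//.
  have e : expR (- (t * psi (x * expR v))) <= expR (1 / 8) * expR (- (t * psi x)).
    rewrite -expRD ler_expR.
    have : 0 <= t * (psi (x * expR v) - psi x + C) by rewrite mulr_ge0//; lra.
    lra.
  have -> : C * expR (1 + v / 4) * (l x * expR (- (t * psi x))) =
     (C * l x) * (expR (1 + v / 4) * expR (- (t * psi x))) by ring.
  apply: (@le_trans _ _ ((C * expR (v / 8) * l x) * (expR (1 / 8) * expR (- (t * psi x))))).
    by apply: ler_pM => //; exact: ltW.
  have -> : (C * expR (v / 8) * l x) * (expR (1 / 8) * expR (- (t * psi x))) =
    (C * l x) * (expR (v / 8) * expR (1 / 8) * expR (- (t * psi x))) by ring.
  rewrite ler_pM2l ?mulr_gt0// ler_pM2r ?expR_gt0// -expRD ler_expR; lra.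
have nv0 : 0 <= - v by lra.
have ex : x * expR v * expR (- v) = x by rewrite -mulrA -expRD subrr expR0 mulr1.
have [h _] := h2 _ _ yA nv0; have /andP[_ g] := h3 _ _ yA nv0.
rewrite ex in h g.
rewrite ltr0_norm//.
have e : expR (- (t * psi (x * expR v))) <= expR ((1 - v) / 8) * expR (- (t * psi x)).
  rewrite -expRD ler_expR.
  have : 0 <= t * (C * (1 - v) - (psi x - psi (x * expR v))) by rewrite mulr_ge0//; lra.
  have : 0 <= (1 - v) * (1 / 8 - t * C) by rewrite mulr_ge0//; lra.
  lra.
have -> : C * expR (1 + (- v) / 4) * (l x * expR (- (t * psi x))) =
   (C * l x) * (expR (1 + (- v) / 4) * expR (- (t * psi x))) by ring.
apply: (@le_trans _ _ ((C * expR ((- v) / 8) * l x) * (expR ((1 - v) / 8) * expR (- (t * psi x))))).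
  by apply: ler_pM => //; exact: ltW.
have -> : (C * expR ((- v) / 8) * l x) * (expR ((1 - v) / 8) * expR (- (t * psi x))) =
  (C * l x) * (expR ((- v) / 8) * expR ((1 - v) / 8) * expR (- (t * psi x))) by ring.
rewrite ler_pM2l ?mulr_gt0// ler_pM2r ?expR_gt0// -expRD ler_expR; lra.
Qed.

(** Comparison of [x] with the threshold [A], where the profile is at least [l A * exp (- B)]
    because [t <= 1]. Low-frequency errors are absorbed into this bound. *)
Lemma profile_lower : exists2 C' : R, 0 < C' & forall t x, 0 <= t -> t <= 1 -> t * C <= 1 / 8 ->
  A <= x -> expR (- (ln x / 4)) <= C' * L t x.
Proof.
case: (tame) => A1 C1 h1 h2 h3.
have [lA _] := h1 A (lexx A).
have A0 : 0 < A by lra.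
exists (C * expR (1 + B) / l A).
  by rewrite divr_gt0// mulr_gt0 ?expR_gt0//; lra.
move=> t x t0 t1 tC xA.
have x0 : 0 < x by lra.
have v0 : 0 <= ln x - ln A by rewrite subr_ge0 ler_ln.
have xE : A = x * expR (- (ln x - ln A)).
  by rewrite opprB expRD expRN !lnK ?posrE// mulrCA mulfV ?mulr1// gt_eqF.
have yA : A <= x * expR (- (ln x - ln A)) by rewrite -xE.
have := @profile_compare t x (- (ln x - ln A)) t0 tC xA yA.
rewrite -xE normrN ger0_norm// => h.
have eB : expR (- B) <= expR (- (t * psi A)).
  rewrite ler_expR lerN2; have := @psiB A ltac:(lra) ltac:(lra) => pB.
  have p0 := @psi0 A ltac:(lra).
  by apply: le_trans pB; rewrite ler_piMl.
have lnA : 0 <= ln A by rewrite ln_ge0.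
have h' : l A * expR (- B) <= C * expR (1 + (ln x - ln A) / 4) * L t x.
  by apply: le_trans h; rewrite ler_pM2l.
have Lp := profile_gt0 t xA.
have h4 : expR (- (ln x / 4)) * expR (- B) <= C * expR 1 * L t x / l A.
  rewrite ler_pdivlMr//.
  have : expR (- (ln x / 4)) * (l A * expR (- B)) <=
     expR (- (ln x / 4)) * (C * expR (1 + (ln x - ln A) / 4) * L t x).
    by rewrite ler_pM2l ?expR_gt0.
  have -> : expR (- (ln x / 4)) * (C * expR (1 + (ln x - ln A) / 4) * L t x) =
     C * (expR (- (ln x / 4)) * expR (1 + (ln x - ln A) / 4)) * L t x by ring.
  have : expR (- (ln x / 4)) * expR (1 + (ln x - ln A) / 4) <= expR 1.
    by rewrite -expRD ler_expR; lra.
  move=> i1 i2.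
  have : C * (expR (- (ln x / 4)) * expR (1 + (ln x - ln A) / 4)) * L t x <= C * expR 1 * L t x.
    by rewrite ler_pM2r// ler_pM2l//; lra.
  lra.
have eBp : expR B * expR (- B) = 1 by rewrite -expRD subrr expR0.
have := ler_wpM2l (expR_ge0 B) h4.
rewrite mulrCA eBp mulr1 => h5; apply: (le_trans h5).
rewrite expRD le_eqVlt; apply/orP; left; apply/eqP.
by field; rewrite gt_eqF.
Qed.

(** Above [A] the increment of [psi] is at most [C * l] and the profile is compared with the one at
    [x]; the cost [exp (|v| / 4)] is below the sum of the two exponentials. Below [A] the doubled
    frequency stays below [2 * A], so the increment is at most [B]; there [exp (- v / 2)] is at
    least [(x / A)^(1/2)], which outweighs the [x^(-1/4)] of [profile_lower]. *)
Lemma increment_upper : exists2 C' : R, 0 < C' & forall t x v, 0 <= t -> t <= 1 -> t * C <= 1 / 8 ->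
  A <= x -> expR (- (t * psi (x * expR v))) - expR (- (t * psi (2 * (x * expR v)))) <=
    t * (C' * L t x) * (expR (- (v / 2)) + expR v).
Proof.
case: (tame) => A1 C1 h1 h2 h3.
have [C' C'0 HC'] := profile_lower.
have B0 : 0 <= B by apply: le_trans (@psiB 0 _ _); [exact: psi0|lra|lra].
have eA : 0 < expR (ln A / 2) := expR_gt0 _.
exists (C * C * expR 1 + B * expR (ln A / 2) * C').
  have : 0 <= B * expR (ln A / 2) * C' by rewrite !mulr_ge0// ltW.
  have : 0 < C * C * expR 1 by rewrite !mulr_gt0 ?expR_gt0//; lra.
  lra.
move=> t x v t0 t1 tC xA.
have Lp := profile_gt0 t xA.
have x0 : 0 < x by lra.
have y0 : 0 < x * expR v by rewrite mulr_gt0 ?expR_gt0.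
have e1 := expR_gt0 (- (v / 2)); have e2 := expR_gt0 v.
have /andP[_ up] := expR_diff_bounds t (psi (x * expR v)) (psi (2 * (x * expR v))).
apply: (le_trans up).
rewrite -!(mulrA t) ler_wpM2l//.
have lx0 : 0 <= l x by have [/ltW] := h1 _ xA.
have CC0 : 0 <= C by lra.
have C'00 := ltW C'0.
have W0 : 0 <= expR (- (v / 2)) + expR v by lra.
have p1 : 0 <= C * C * expR 1 * L t x * (expR (- (v / 2)) + expR v).
  by rewrite !mulr_ge0 ?expR_ge0.
have p2 : 0 <= B * expR (ln A / 2) * C' * L t x * (expR (- (v / 2)) + expR v).
  by rewrite !mulr_ge0 ?expR_ge0.
suff : (psi (2 * (x * expR v)) - psi (x * expR v)) * expR (- (t * psi (x * expR v))) <=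
    C * C * expR 1 * L t x * (expR (- (v / 2)) + expR v) \/
   (psi (2 * (x * expR v)) - psi (x * expR v)) * expR (- (t * psi (x * expR v))) <=
    B * expR (ln A / 2) * C' * L t x * (expR (- (v / 2)) + expR v).
  by case; lra.
have ep := expR_gt0 (- (t * psi (x * expR v))).
have [yA|yA] := lerP A (x * expR v); [left|right].
  have [ly /andP[_ D]] := h1 _ yA.
  have D' : psi (2 * (x * expR v)) - psi (x * expR v) <= C * l (x * expR v).
    by move: D; rewrite ler_pM2l//; lra.
  apply: (@le_trans _ _ (C * L t (x * expR v))).
    by rewrite (mulrA C) ler_pM2r.
  have := profile_compare t0 tC xA yA => cmp.
  have C0 : 0 <= C by lra.
  apply: (le_trans (ler_wpM2l C0 cmp)).
  rewrite expRD.
  have ev : expR (`|v| / 4) <= expR (- (v / 2)) + expR v.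
    have [v0|v0] := lerP 0 v.
      have : expR (`|v| / 4) <= expR v by rewrite ger0_norm// ler_expR; lra.
      lra.
    have : expR (`|v| / 4) <= expR (- (v / 2)) by rewrite ltr0_norm// ler_expR; lra.
    lra.
  have -> : C * (C * (expR 1 * expR (`|v| / 4)) * L t x) = (C * C * expR 1 * L t x) * expR (`|v| / 4).
    by ring.
  by rewrite ler_wpM2l// !mulr_ge0 ?expR_ge0.
have D : psi (2 * (x * expR v)) - psi (x * expR v) <= B.
  have := @psiB (2 * (x * expR v)) ltac:(lra) ltac:(lra).
  by have := @psi0 (x * expR v) ltac:(lra); lra.
have ele : expR (- (t * psi (x * expR v))) <= 1.
  by rewrite -expR0 ler_expR oppr_le0 mulr_ge0// psi0// ltW.
have D1 : (psi (2 * (x * expR v)) - psi (x * expR v)) * expR (- (t * psi (x * expR v))) <= B.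
  apply: (@le_trans _ _ (B * expR (- (t * psi (x * expR v))))); first by rewrite ler_wpM2r// ltW.
  by rewrite ler_piMr.
apply: (le_trans D1).
have lnA : ln x + v <= ln A.
  by rewrite -[X in _ + X]expRK -lnM ?posrE ?expR_gt0// ler_ln ?posrE ?ltW//; lra.
have one : 1 <= expR (ln A / 2) * (expR (- (ln x / 4)) * expR (- (v / 2))).
  rewrite -!expRD -[leLHS]expR0 ler_expR.
  have : 0 <= ln x by rewrite ln_ge0//; lra.
  lra.
have := HC' t x t0 t1 tC xA => h4.
have : 1 <= expR (ln A / 2) * (C' * L t x * (expR (- (v / 2)) + expR v)).
  apply: (le_trans one); rewrite ler_pM2l//.
  by apply: ler_pM; rewrite ?expR_ge0//; lra.
move=> h5; have := ler_wpM2l B0 h5; rewrite mulr1 => h6; lra.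
Qed.

(** The increment of [psi] can be negative only below [A], where it is at least [- B] and where
    [x * exp v < A] supplies both exponentials. The power [x^(-1/2)] leaves a spare [x^(-1/4)]
    against [profile_lower]. *)
Lemma increment_lower : exists2 B' : R, 0 <= B' & forall t x v, 0 <= t ->
  A <= x -> - (t * B' * expR (- (ln x / 2)) * expR (- (v / 2))) <=
    expR (- (t * psi (x * expR v))) - expR (- (t * psi (2 * (x * expR v)))).
Proof.
case: (tame) => A1 C1 h1 h2 h3.
have B0 : 0 <= B by apply: le_trans (@psiB 0 _ _); [exact: psi0|lra|lra].
have eA : 0 < expR (ln A / 2) := expR_gt0 _.
exists (B * expR (ln A / 2)); first by rewrite mulr_ge0// ltW.
move=> t x v t0 xA.
have x0 : 0 < x by lra.
have y0 : 0 < x * expR v by rewrite mulr_gt0 ?expR_gt0.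
have e1 := expR_gt0 (- (v / 2)); have e2 := expR_gt0 (- (ln x / 2)).
have /andP[lo _] := expR_diff_bounds t (psi (x * expR v)) (psi (2 * (x * expR v))).
apply: le_trans lo.
have ep := expR_gt0 (- (t * psi (2 * (x * expR v)))).
have [yA|yA] := lerP A (x * expR v).
  have [ly /andP[D _]] := h1 _ yA.
  have D' : 0 <= psi (2 * (x * expR v)) - psi (x * expR v).
    have : 0 < C * (psi (2 * (x * expR v)) - psi (x * expR v)) by lra.
    by rewrite pmulr_rgt0; lra.
  apply: (@le_trans _ _ 0); last by rewrite !mulr_ge0// ltW.
  by rewrite oppr_le0 !mulr_ge0// ltW.
have D : - B <= psi (2 * (x * expR v)) - psi (x * expR v).
  have := @psiB (x * expR v) ltac:(lra) ltac:(lra).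
  by have := @psi0 (2 * (x * expR v)) ltac:(lra); lra.
have ele : expR (- (t * psi (2 * (x * expR v)))) <= 1.
  by rewrite -[leRHS]expR0 ler_expR oppr_le0 mulr_ge0// psi0//; lra.
have D1 : - B <= (psi (2 * (x * expR v)) - psi (x * expR v)) * expR (- (t * psi (2 * (x * expR v)))).
  have : - B * expR (- (t * psi (2 * (x * expR v)))) <= (psi (2 * (x * expR v)) - psi (x * expR v)) * expR (- (t * psi (2 * (x * expR v)))).
    by rewrite ler_wpM2r// ltW.
  have : B * expR (- (t * psi (2 * (x * expR v)))) <= B by rewrite ler_piMr.
  lra.
have lnA : ln x + v <= ln A.
  by rewrite -[X in _ + X]expRK -lnM ?posrE ?expR_gt0// ler_ln ?posrE ?ltW//; lra.
have one : 1 <= expR (ln A / 2) * (expR (- (ln x / 2)) * expR (- (v / 2))).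
  by rewrite -!expRD -[leLHS]expR0 ler_expR; lra.
have := ler_wpM2l B0 one; rewrite mulr1 => h6.
have := ler_wpM2l t0 D1; have := ler_wpM2l t0 h6.
rewrite -!mulrA => *; lra.
Qed.

(** Upward dilations stay above [A], so the increment of [psi] is truly of order [l x] when they are
    bounded. *)
Lemma increment_box (V : R) : 0 <= V -> exists2 c : R, 0 < c & forall t x v, 0 <= t -> t * C <= 1 / 8 ->
  A <= x -> 0 <= v -> v <= V -> t * (c * L t x) <=
    expR (- (t * psi (x * expR v))) - expR (- (t * psi (2 * (x * expR v)))).
Proof.
case: (tame) => A1 C1 h1 h2 h3 V0.
have C0 : 0 < C by lra.
(* The losses [exp (- V / 8)] from [l] and [exp (- (V + 2) / 8)] from [psi] at the doubled frequency
   multiply to at least [exp (- (V + 1))]. *)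
exists (expR (- (V + 1)) / (C * C)); first by rewrite divr_gt0 ?expR_gt0// mulr_gt0.
move=> t x v t0 tC xA v0 vV.
have [lx _] := h1 _ xA.
have yA : A <= x * expR v.
  have : 1 <= expR v by have := expR_ge1Dx v; lra.
  move=> ev; apply: (le_trans xA); rewrite ler_peMr//; lra.
have [ly /andP[D _]] := h1 _ yA.
have [h _] := h2 _ _ xA v0.
have ln2 : ln 2 <= 1 :> R by have := @le_ln1Dx R 1 ltac:(lra); rewrite (_ : 1 + 1 = 2)//; lra.
have ln20 : 0 <= ln 2 :> R by rewrite ln_ge0//; lra.
have e2 : 2 * (x * expR v) = x * expR (v + ln 2).
  by rewrite expRD lnK ?posrE//; ring.
have /andP[_ g] := h3 x (v + ln 2) xA ltac:(lra).
have /andP[lo _] := expR_diff_bounds t (psi (x * expR v)) (psi (2 * (x * expR v))).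
apply: le_trans lo; rewrite -!(mulrA t) ler_wpM2l//.
set y := x * expR v in D h ly yA e2 *.
have eL : expR (- ((V + 2) / 8)) * expR (- (t * psi x)) <= expR (- (t * psi (2 * y))).
  rewrite e2 -expRD ler_expR.
  have : 0 <= t * (C * (1 + (v + ln 2)) - (psi (x * expR (v + ln 2)) - psi x)) by rewrite mulr_ge0//; lra.
  have : 0 <= (1 + (v + ln 2)) * (1 / 8 - t * C) by rewrite mulr_ge0//; lra.
  lra.
have D2 : expR (- (V / 8)) / (C * C) * l x <= psi (2 * y) - psi y.
  rewrite mulrAC ler_pdivrMr ?mulr_gt0//.
  have i1 : expR (- (v / 8)) * l x <= C * l y.
    have := ler_wpM2l (expR_ge0 (- (v / 8))) h.
    have -> : expR (- (v / 8)) * (C * expR (v / 8) * l y) = C * l y * (expR (v / 8) * expR (- (v / 8))) by ring.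
    by rewrite -expRD subrr expR0 mulr1.
  have i2 : expR (- (V / 8)) * l x <= expR (- (v / 8)) * l x.
    by rewrite ler_pM2r// ler_expR; lra.
  have := ler_wpM2l (ltW C0) D; lra.
have := ler_pM _ _ D2 eL.
rewrite !mulr_ge0 ?expR_ge0 ?invr_ge0 ?mulr_ge0 ?(ltW lx) ?(ltW C0)// => /(_ erefl erefl).
apply: le_trans.
have -> : expR (- (V / 8)) / (C * C) * l x * (expR (- ((V + 2) / 8)) * expR (- (t * psi x))) =
   expR (- (V / 8)) * expR (- ((V + 2) / 8)) * (l x * expR (- (t * psi x)) / (C * C)).
  by field; rewrite gt_eqF.
have -> : expR (- (V + 1)) / (C * C) * (l x * expR (- (t * psi x))) =
   expR (- (V + 1)) * (l x * expR (- (t * psi x)) / (C * C)).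
  by field; rewrite gt_eqF.
rewrite ler_pM2r; last by rewrite divr_gt0 ?mulr_gt0 ?expR_gt0.
by rewrite -expRD ler_expR; lra.
Qed.

End exponent_bounds.

(** * Iterated integrals and characteristic functions *)

Section leb_int_theory.
Variable R : realType.

Import HBNNSimple.

(** The integral of a nonnegative function is a supremum over simple functions below it, so
    monotonicity holds without measurability. This is what iterated integrals require, as their
    inner integrals come with no measurability proof. *)
Lemma le_integral_ge0 d (T : measurableType d) (mu : {measure set T -> \bar R}) (f g : T -> \bar R) :
  (forall x, 0 <= f x)%E -> (forall x, f x <= g x)%E -> (\int[mu]_x f x <= \int[mu]_x g x)%E.
Proof.
move=> f0 fg; have g0 x : (0 <= g x)%E by exact: le_trans (f0 x) (fg x).
rewrite !ge0_integralTE//; apply: ge_ereal_sup => _ [h hf <-].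
by apply: ereal_sup_ubound; exists h => // x; exact: le_trans (hf x) (fg x).
Qed.

Lemma leb_int_ge0 d (f : d.-tuple R -> \bar R) : (forall x, 0 <= f x)%E -> (0 <= leb_int f)%E.
Proof.
elim: d f => [|d IH] f f0 /=; first exact: f0.
by apply: integral_ge0 => x _; apply: IH.
Qed.

Lemma le_leb_int d (f g : d.-tuple R -> \bar R) :
  (forall x, 0 <= f x)%E -> (forall x, f x <= g x)%E -> (leb_int f <= leb_int g)%E.
Proof.
elim: d f g => [|d IH] f g f0 fg /=; first exact: fg.
apply: le_integral_ge0 => x; first exact: leb_int_ge0.
exact: IH.
Qed.

(** The free factor [c] absorbs the indicator of the outermost coordinate in the induction. *)
Lemma leb_int_box d (a b c : R) : a < b -> 0 <= c ->
  leb_int (fun x : d.-tuple R => (c * \prod_(i < d) \1_(`[a, b]) (tnth x i))%:E) =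
  (c * (b - a) ^+ d)%:E.
Proof.
move=> ab; elim: d c => [|d IH] c c0 /=; first by rewrite big_ord0 expr0.
transitivity (\int[@lebesgue_measure R]_x ((c * (b - a) ^+ d)%:E * (\1_(`[a, b]%classic) x)%:E))%E.
  apply: eq_integral => x _.
  transitivity (leb_int (fun t : d.-tuple R =>
      (c * \1_(`[a, b]%classic) x * \prod_(i < d) \1_(`[a, b]%classic) (tnth t i))%:E)).
    congr leb_int; apply/funext => t; rewrite big_ord_recl tnth0 mulrA.
    by congr ((_ * _)%:E); apply: eq_bigr => i _; rewrite tnthS.
  by rewrite IH ?mulr_ge0// -EFinM; congr EFin; ring.
have ba : 0 <= b - a by lra.
rewrite ge0_integralZl//=.
- rewrite integral_indic//= setIT lebesgue_measure_itv/= lte_fin ab -EFinB -EFinM.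
  by congr EFin; rewrite exprSr mulrA.
- by apply/measurable_EFinP.
- by rewrite lee_fin mulr_ge0// exprn_ge0.
Qed.

End leb_int_theory.

Section vectors.
Variables (R : realType) (d : nat).
Implicit Types x z : d.-tuple R.

Lemma vnorm_ge0 x : 0 <= vnorm x. Proof. exact: sqrtr_ge0. Qed.

Lemma vdotxx x : vdot x x = sqnorm (tnth x).
Proof. by rewrite /vdot /sqnorm; apply: eq_bigr => i _; rewrite expr2. Qed.

Lemma sqr_vnorm x : vnorm x ^+ 2 = sqnorm (tnth x).
Proof.
rewrite /vnorm sqr_sqrtr vdotxx//; apply: sumr_ge0 => i _; exact: sqr_ge0.
Qed.

Lemma measurable_vnorm : measurable_fun setT (fun x : d.-tuple R => vnorm x).
Proof.
apply: (measurableT_comp (continuous_measurable_fun (@sqrt_continuous R))).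
apply: measurable_sum => i; apply: measurable_funM; exact: measurable_tnth.
Qed.

Definition vscale (c : R) x : d.-tuple R := [tuple c * tnth x i | i < d].

Lemma vnorm_vscale c x : 0 <= c -> vnorm (vscale c x) = c * vnorm x.
Proof.
move=> c0; rewrite /vnorm !vdotxx.
have -> : sqnorm (tnth (vscale c x)) = c ^+ 2 * sqnorm (tnth x).
  by rewrite /sqnorm mulr_sumr; apply: eq_bigr => i _; rewrite tnth_mktuple exprMn.
by rewrite sqrtrM ?sqr_ge0// sqrtr_sqr ger0_norm.
Qed.

Definition vaxis (i0 : 'I_d) (u : R) : d.-tuple R := [tuple if i == i0 then u else 0 | i < d].

Lemma vdot_vaxis i0 u x : vdot (vaxis i0 u) x = u * tnth x i0.
Proof.
rewrite /vdot (bigD1 i0)//= big1 ?addr0; first by rewrite tnth_mktuple eqxx.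
by move=> i /negbTE ni; rewrite tnth_mktuple ni mul0r.
Qed.

Lemma vnorm_vaxis i0 u : vnorm (vaxis i0 u) = `|u|.
Proof. by rewrite /vnorm vdot_vaxis tnth_mktuple eqxx -expr2 sqrtr_sqr. Qed.

End vectors.

(** * The exponent read off the characteristic function, and the mean of the kernel *)

Section characteristic_function.
Context (R : realType) (dT : measure_display) (T : measurableType dT) (P : probability T R).

Lemma charfun_continuous (Y : T -> R) : measurable_fun setT Y ->
  continuous (fun u : R => fine (\int[P]_w (cos (u * Y w))%:E)%E : R).
Proof.
move=> mY u.
have mc (a : R) : measurable_fun setT (fun w => cos (a * Y w)).
  apply: (measurableT_comp (continuous_measurable_fun (@continuous_cos R))).
  exact: measurable_funM.
have c1 (a : R) w : `|cos (a * Y w)| <= 1 by rewrite ler_norml cos_geN1 cos_le1.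
apply: (@continuity_under_integral R _ T P (fun u w => cos (u * Y w)) setT measurableT
   (u - 1) (u + 1) _ _ (cst 1)).
- by move=> a _; apply: (@prob_bounded_integrable R _ _ P _ 1).
- apply: aeW => w _ a _ /=.
  apply: continuous_comp; last exact: continuous_cos.
  by apply: cvgM; [exact: cvg_id|exact: cvg_cst].
- exact: finite_measure_integrable_cst.
- by move=> a _; apply: aeW => w _; exact: c1.
- by rewrite inE/= in_itv/=; apply/andP; split; lra.
Qed.

Variables (d : nat) (d_gt0 : (0 < d)%N) (X : R -> T -> d.-tuple R) (psi : R -> R).
Hypothesis mX : forall t, 0 <= t -> measurable_fun setT (X t).
Hypothesis Hchar : forall t, 0 <= t -> forall xi : d.-tuple R,
  (\int[P]_w (cos (vdot xi (X t w)))%:E = (expR (- (t * psi (vnorm xi))))%:E)%E.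

Let i0 := Ordinal d_gt0.

Let charE u : (\int[P]_w (cos (u * tnth (X 1 w) i0))%:E = (expR (- psi `|u|))%:E)%E.
Proof.
have := Hchar ler01 (vaxis i0 u); rewrite vnorm_vaxis mul1r => <-.
by apply: eq_integral => w _; rewrite vdot_vaxis.
Qed.

Let mX1 : measurable_fun setT (fun w => tnth (X 1 w) i0).
Proof. by apply: (measurableT_comp (measurable_tnth i0)); exact: mX ler01. Qed.

(** [exp (- psi |u|)] is the characteristic function of one coordinate of [X 1], continuous by
    dominated convergence and positive, and [psi] is minus its logarithm. The absolute value keeps
    the argument among norms, where the characteristic function determines [psi]. *)
Lemma exponent_continuous : continuous (fun u : R => psi `|u|).
Proof.
move=> u.
have -> : (fun u : R => psi `|u|) = (fun u : R => - ln (fine (\int[P]_w (cos (u * tnth (X 1 w) i0))%:E)%E)).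
  by apply/funext => v; rewrite charE /= expRK opprK.
apply: cvgN; apply: continuous_comp; first exact: charfun_continuous.
by rewrite charE /=; apply: continuous_ln; exact: expR_gt0.
Qed.

Lemma exponent_ge0 u : 0 <= u -> 0 <= psi u.
Proof.
move=> u0; rewrite -(ger0_norm u0) -oppr_le0 -ler_expR expR0 -lee_fin -charE.
have -> : 1%:E = (\int[P]_w (cst 1%E w))%E.
  by rewrite integral_cst// mul1e; apply/esym; exact: probability_setT.
apply: le_integral => //.
- apply: (@prob_bounded_integrable R _ _ P _ 1).
    apply: (measurableT_comp (continuous_measurable_fun (@continuous_cos R))).
    exact: measurable_funM.
  by move=> w; rewrite ler_norml cos_geN1 cos_le1.
- exact: finite_measure_integrable_cst.
- by move=> w _; rewrite lee_fin cos_le1.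
Qed.

Variable Q : probability (d.-tuple R) R.
Hypothesis HQ : forall y : 'I_d -> R,
  (\int[Q]_z (cos (\sum_(i < d) tnth z i * y i))%:E = (cauchy_prod y)%:E)%E.

Lemma expectation_cauchy_prod (t lam : R) : 0 <= t -> 0 <= lam ->
  (\int[P]_w (cauchy_prod (fun i => lam * tnth (X t w) i))%:E =
   \int[Q]_z (expR (- (t * psi (lam * vnorm z))))%:E)%E.
Proof.
move=> t0 l0.
pose f (wz : T * d.-tuple R) := cos (\sum_(i < d) tnth wz.2 i * (lam * tnth (X t wz.1) i)).
have mf : measurable_fun setT f.
  apply: (measurableT_comp (continuous_measurable_fun (@continuous_cos R))).
  apply: measurable_sum => i; apply: measurable_funM.
    exact: (measurableT_comp (measurable_tnth i) measurable_snd).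
  apply: measurable_funM => //.
  exact: (measurableT_comp (measurable_tnth i) (measurableT_comp (mX t0) measurable_fst)).
have int_f : (P \x Q)%E.-integrable setT (fun wz => (f wz)%:E).
  by apply: (@prob_bounded_integrable R _ _ (P \x Q)%E _ 1) => // wz; rewrite ler_norml cos_geN1 cos_le1.
have := Fubini int_f; rewrite /f/= => h.
transitivity (\int[P]_x \int[Q]_y (cos (\sum_(i < d) tnth y i * (lam * tnth (X t x) i)))%:E)%E.
  by apply: eq_integral => w _; rewrite HQ.
rewrite h; apply: eq_integral => z _.
rewrite -(vnorm_vscale _ l0) -(Hchar t0); apply: eq_integral => w _; congr (cos _)%:E.
by rewrite /vdot; apply: eq_bigr => i _; rewrite tnth_mktuple; ring.
Qed.

Lemma measurable_expR_exponent (t lam : R) : 0 <= lam ->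
  measurable_fun setT (fun z : d.-tuple R => expR (- (t * psi (lam * vnorm z)))).
Proof.
move=> l0; apply: (measurableT_comp (@measurable_expR R)); apply: measurable_funN.
apply: measurable_funM => //.
rewrite (_ : (fun x => _) = (fun u : R => psi `|u|) \o (fun z : d.-tuple R => lam * vnorm z)).
  apply: (measurableT_comp (continuous_measurable_fun exponent_continuous)).
  by apply: measurable_funM => //; exact: measurable_vnorm.
by apply/funext => z /=; rewrite ger0_norm// mulr_ge0// vnorm_ge0.
Qed.

Lemma integrable_expR_exponent (t lam : R) : 0 <= t -> 0 <= lam ->
  Q.-integrable setT (fun z : d.-tuple R => (expR (- (t * psi (lam * vnorm z))))%:E).
Proof.
move=> t0 l0; apply: (@prob_bounded_integrable R _ _ Q _ 1); first exact: measurable_expR_exponent.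
move=> z; rewrite gtr0_norm ?expR_gt0// -expR0 ler_expR oppr_le0 mulr_ge0// exponent_ge0//.
by rewrite mulr_ge0// vnorm_ge0.
Qed.

Lemma measurable_cauchy_prod (t lam : R) : 0 <= t ->
  measurable_fun setT (fun w => cauchy_prod (fun i => lam * tnth (X t w) i)).
Proof.
move=> t0; apply: measurable_prod => i _.
apply: (measurableT_comp (f := fun u : R => (1 + (lam * u) ^+ 2)^-1) (g := fun w => tnth (X t w) i)).
  apply: continuous_measurable_fun => u.
  apply: cvgV; first by rewrite gt_eqF//; have := sqr_ge0 (lam * u); lra.
  apply: cvgD; first exact: cvg_cst.
  apply: cvgM; (apply: cvgM; [exact: cvg_cst|exact: cvg_id]).
exact: (measurableT_comp (measurable_tnth i) (mX t0)).
Qed.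

Lemma integrable_cauchy_prod (t lam : R) : 0 <= t ->
  P.-integrable setT (fun w => (cauchy_prod (fun i => lam * tnth (X t w) i))%:E).
Proof.
move=> t0; apply: (@prob_bounded_integrable R _ _ P _ 1); first exact: measurable_cauchy_prod.
by move=> w; have /andP[c0 c1] := cauchy_prod_bounds (fun i => lam * tnth (X t w) i); rewrite gtr0_norm.
Qed.

Lemma expectation_cauchy_diff (t lam : R) : 0 <= t -> 0 <= lam ->
  (\int[P]_w (cauchy_diff (fun i => lam * tnth (X t w) i))%:E =
   \int[Q]_z (expR (- (t * psi (lam * vnorm z))) - expR (- (t * psi (2 * (lam * vnorm z)))))%:E)%E.
Proof.
move=> t0 l0; have l20 : 0 <= 2 * lam by lra.
transitivity (\int[P]_w ((cauchy_prod (fun i => lam * tnth (X t w) i))%:E -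
   (cauchy_prod (fun i => 2 * lam * tnth (X t w) i))%:E))%E.
  apply: eq_integral => w _; rewrite /cauchy_diff EFinB; congr (_ - _)%E.
  by congr (cauchy_prod _)%:E; apply/funext => i; rewrite mulrA.
rewrite integralB//; [|exact: integrable_cauchy_prod|exact: integrable_cauchy_prod].
rewrite !expectation_cauchy_prod//.
transitivity (\int[Q]_z ((expR (- (t * psi (lam * vnorm z))))%:E -
   (expR (- (t * psi (2 * lam * vnorm z))))%:E))%E.
  by rewrite integralB//; exact: integrable_expR_exponent.
by apply: eq_integral => z _; rewrite EFinB mulrA.
Qed.

End characteristic_function.

(** * Bounds on the transform *)

Section gauge.
Variables (R : realType) (d : nat).
Implicit Types z : d.-tuple R.

Definition weight (u : R) : R := `|u| `^ (- (1 / 2)) + expR (`|u| / 2).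

Lemma weight_ge1 u : 1 <= weight u.
Proof.
have : 0 <= `|u| `^ (- (1 / 2)) by exact: powR_ge0.
have := expR_ge1Dx (`|u| / 2); have := normr_ge0 u; rewrite /weight; lra.
Qed.

Lemma measurable_weight : measurable_fun setT weight.
Proof.
apply: measurable_funD.
  exact: (measurableT_comp (@measurable_powR R _) (@normr_measurable R setT)).
apply: (measurableT_comp (@measurable_expR R)).
by apply: measurable_funM => //; exact: normr_measurable.
Qed.

Lemma coord_le_vnorm z i : `|tnth z i| <= vnorm z.
Proof.
rewrite -ler_sqr ?nnegrE ?vnorm_ge0//; rewrite sqr_vnorm real_normK ?num_real//.
exact: coord_le_sqnorm.
Qed.

Lemma vnorm_le_sum z : vnorm z <= \sum_(i < d) `|tnth z i|.
Proof.
have s0 : 0 <= \sum_(i < d) `|tnth z i| by apply: sumr_ge0.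
rewrite -ler_sqr ?nnegrE ?vnorm_ge0// sqr_vnorm expr2 mulr_suml.
apply: ler_sum => i _; rewrite -[tnth z i ^+ 2]ger0_norm ?sqr_ge0// normrX expr2.
by rewrite ler_wpM2l// (bigD1 i)//= lerDl sumr_ge0.
Qed.

(** The bound is a product over coordinates so that its integral under the product law factorises.
    For large norms, [|z| <= sum |z_i| <= 2 exp (sum |z_i| / 2)]; for small ones,
    [|z|^(-1/2) <= |z_i|^(-1/2)] for any nonzero coordinate, the other weights being at least 1. The
    power -1/2 is integrable in one variable, whatever [d]. *)
Lemma vnorm_weight z : 0 < vnorm z ->
  expR (- (ln (vnorm z) / 2)) + expR (ln (vnorm z)) <= 3 * \prod_(i < d) weight (tnth z i).
Proof.
move=> z0.
have h1 : expR (ln (vnorm z)) <= 2 * \prod_(i < d) weight (tnth z i).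
  rewrite lnK ?posrE//; apply: (le_trans (vnorm_le_sum z)).
  have e : (\sum_(i < d) `|tnth z i|) <= 2 * expR ((\sum_(i < d) `|tnth z i|) / 2).
    by have := expR_ge1Dx ((\sum_(i < d) `|tnth z i|) / 2); lra.
  apply: (le_trans e); rewrite ler_pM2l// mulr_suml expR_sum.
  apply: ler_prod => i _; rewrite expR_ge0/= /weight lerDr; exact: powR_ge0.
have [i zi] : exists i, tnth z i != 0.
  apply: contrapT => H; move: z0; rewrite lt_neqAle eq_sym => /andP[/eqP + _]; apply.
  apply/eqP; rewrite -sqrf_eq0 sqr_vnorm /sqnorm big1// => j _.
  by apply/eqP; rewrite sqrf_eq0; apply/negPn/negP => nj; apply: H; exists j.
have zi0 : 0 < `|tnth z i| by rewrite normr_gt0.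
have h2 : expR (- (ln (vnorm z) / 2)) <= \prod_(j < d) weight (tnth z j).
  apply: (@le_trans _ _ (weight (tnth z i))).
    rewrite /weight; apply: ler_wpDr; first exact: expR_ge0.
    rewrite /powR gt_eqF// ler_expR.
    have : ln `|tnth z i| <= ln (vnorm z) by rewrite ler_ln ?posrE// coord_le_vnorm.
    lra.
  rewrite (bigD1 i)//= ler_peMr//; first by have := weight_ge1 (tnth z i); lra.
  have : \prod_(j < d | j != i) (1 : R) <= \prod_(j < d | j != i) weight (tnth z j).
    by apply: ler_prod => j _; rewrite ler01 weight_ge1.
  by rewrite big1_eq.
by lra.
Qed.

Lemma vnorm_box z : (0 < d)%N -> (forall i, 1 <= tnth z i <= 2) ->
  1 <= vnorm z <= 2 * d%:R.
Proof.
move=> d0 hz; have d1 : 1 <= d%:R :> R by rewrite ler1n.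
have z1 i : `|tnth z i| <= 2 by have := hz i => /andP[a b]; rewrite ger0_norm; lra.
apply/andP; split.
  apply: le_trans (coord_le_vnorm z (Ordinal d0)).
  by have /andP[a _] := hz (Ordinal d0); apply: (le_trans a); exact: ler_norm.
apply: (le_trans (vnorm_le_sum z)); rewrite mulr_natr -[d in X in _ <= X]card_ord -sumr_const.
exact: ler_sum.
Qed.

(** Written as a product of one-variable functions, the form that [tuple_law] and [leb_int_box]
    integrate. *)
Definition boxind (a b : R) z : R := \prod_(i < d) \1_(`[a, b]%classic) (tnth z i).

Lemma boxind1 a b z : (forall i, a <= tnth z i <= b) -> boxind a b z = 1.
Proof.
by move=> h; rewrite /boxind big1// => i _; rewrite indicE mem_set//= in_itv/= h.
Qed.

Lemma boxind0 a b z : ~ (forall i, a <= tnth z i <= b) -> boxind a b z = 0.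
Proof.
move=> /existsNP[i /negP hi]; rewrite /boxind (bigD1 i)//= indicE memNset ?mul0r//=.
by rewrite in_itv/=; exact/negP.
Qed.

Lemma boxindP a b z : boxind a b z = 1 <-> (forall i, a <= tnth z i <= b).
Proof.
split; last exact: boxind1.
move=> h; apply: contrapT => /boxind0; rewrite h => /eqP.
by rewrite oner_eq0.
Qed.

Lemma boxind_ge0 a b z : 0 <= boxind a b z.
Proof. by apply: prodr_ge0. Qed.

Lemma measurable_boxind a b : measurable_fun setT (boxind a b).
Proof. by apply: measurable_prod_coord; exact: measurable_indic. Qed.

End gauge.

Section transform_bounds.
Variables (R : realType) (d : nat) (d_gt0 : (0 < d)%N).
Variables (l psi : R -> R) (A C B : R).
Hypothesis tame : tame_exponent l psi A C.
Hypothesis psi0 : forall u, 0 <= u -> 0 <= psi u.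
Hypothesis psiB : forall u, 0 <= u -> u <= 2 * A -> psi u <= B.
Variable Q : probability (d.-tuple R) R.
Variables (Hc q : R).
Hypothesis HcE : (\int[Q]_z (\prod_(i < d) weight (tnth z i))%:E = Hc%:E)%E.
Hypothesis qE : (\int[Q]_z (boxind 1 2 z)%:E = q%:E)%E.
Hypothesis q_gt0 : 0 < q.

Local Notation L t x := (l x * expR (- (t * psi x))).
Local Notation D t x z := (expR (- (t * psi (x * vnorm z))) - expR (- (t * psi (2 * (x * vnorm z))))).

Hypothesis intD : forall t x, 0 <= t -> 0 <= x -> Q.-integrable setT (fun z => (D t x z)%:E).

Let W (z : d.-tuple R) : R := \prod_(i < d) weight (tnth z i).

Let W0 z : 0 <= W z.
Proof.
rewrite /W; apply: prodr_ge0 => i _.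
have h := weight_ge1 (tnth z i).
exact: (le_trans ler01 h).
Qed.

Let mW : measurable_fun setT W.
Proof. exact: measurable_prod_coord (@measurable_weight R). Qed.

Let intW : Q.-integrable setT (fun z => (W z)%:E).
Proof.
apply/integrableP; split; first exact/measurable_EFinP.
under eq_integral do rewrite gee0_abs ?lee_fin//.
by rewrite HcE ltry.
Qed.

Let Hc0 : 0 <= Hc.
Proof. by rewrite -lee_fin -HcE; apply: integral_ge0 => z _; rewrite lee_fin; exact: W0. Qed.

Let vnormE (z : d.-tuple R) : 0 < vnorm z -> vnorm z = expR (ln (vnorm z)).
Proof. by move=> z0; rewrite lnK. Qed.

Lemma transform_upper : exists2 CU : R, 0 < CU & forall t x, 0 <= t -> t <= 1 -> t * C <= 1 / 8 ->
  A <= x -> (\int[Q]_z (D t x z)%:E <= (t * (CU * L t x))%:E)%E.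
Proof.
have hc := Hc0; have w0 := W0.
have [C' C'0 HC'] := increment_upper tame psi0 psiB.
exists (C' * 3 * (Hc + 1)); first by rewrite !mulr_gt0//; lra.
move=> t x t0 t1 tC xA.
have A1 : 1 <= A by case: tame.
have Lp := profile_gt0 tame t xA.
have k0 : 0 <= t * (C' * L t x) * 3 by rewrite mulr_ge0// mulr_ge0// mulr_ge0 ?ltW.
apply: (@le_trans _ _ (\int[Q]_z ((t * (C' * L t x) * 3)%:E * (W z)%:E))%E).
  apply: le_integral => //.
  - by apply: intD; lra.
  - exact: integrableZl.
  - move=> z _; rewrite -EFinM lee_fin.
    (* At norm 0 the integrand vanishes; [vnorm z] is the exponential of its logarithm only off the
       origin. *)
    have := vnorm_ge0 z; rewrite le_eqVlt => /orP[/eqP <-|z0].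
      by rewrite !mulr0 subrr mulr_ge0.
    rewrite {1 2}(vnormE z0).
    apply: (le_trans (HC' t x (ln (vnorm z)) t0 t1 tC xA)).
    rewrite -(mulrA _ 3); apply: ler_wpM2l; last exact: vnorm_weight.
    by rewrite mulr_ge0// mulr_ge0 ?ltW.
rewrite integralZl// HcE -EFinM lee_fin.
have : 0 <= t * (C' * L t x) * 3 by [].
lra.
Qed.

(** The box [[1, 2]^d] contributes a multiple of [t * L t x]. Elsewhere the integrand is bounded
    below by an error of order [t * x^(-1/2)] times the weight, which for large [x] uses up at most
    half of that contribution. *)
Lemma transform_lower : exists cU x0 : R, [/\ 0 < cU, A <= x0 &
  forall t x, 0 <= t -> t <= 1 -> t * C <= 1 / 8 ->
  x0 <= x -> ((t * (cU * L t x))%:E <= \int[Q]_z (D t x z)%:E)%E].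
Proof.
have hc := Hc0; have w0 := W0.
have A1 : 1 <= A by case: tame.
have [C' C'0 HC'] := profile_lower tame psi0 psiB.
have [B' B'0 HB'] := increment_lower tame psi0 psiB.
have d1 : 1 <= d%:R :> R by rewrite ler1n.
have V0 : 0 <= ln (2 * d%:R) :> R by rewrite ln_ge0//; lra.
have [c c0 Hcc] := increment_box tame V0.
pose E := B' * 3 * Hc * C'.
have E0 : 0 <= E by rewrite !mulr_ge0// ltW.
have cq : 0 < c * q by rewrite mulr_gt0.
(* Chosen so that [ln x >= s0] forces [E * x^(-1/4) <= c * q / 2], through [ln x / 4 <= x^(1/4)]. *)
pose s0 := 4 * (2 * E / (c * q)).
have s00 : 0 <= s0 by rewrite mulr_ge0// divr_ge0 ?mulr_ge0// ltW.
exists (c * q / 2), (Num.max A (expR s0)); split; [lra|by rewrite le_max lexx|].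
move=> t x t0 t1 tC; rewrite ge_max => /andP[xA xs].
have Lp := profile_gt0 tame t xA.
have x0 : 0 < x by lra.
have mb := @measurable_boxind R d 1 2.
have intb : Q.-integrable setT (fun z => (boxind 1 2 z)%:E).
  apply/integrableP; split; first exact/measurable_EFinP.
  under eq_integral do rewrite gee0_abs ?lee_fin ?boxind_ge0//.
  by rewrite qE ltry.
pose k1 := t * (c * L t x); pose k2 := t * B' * expR (- (ln x / 2)) * 3.
apply: (@le_trans _ _ (\int[Q]_z (k1%:E * (boxind 1 2 z)%:E - k2%:E * (W z)%:E))%E); last first.
  apply: le_integral => //.
  - by apply: integrableB => //; exact: integrableZl.
  - by apply: intD; lra.
  - move=> z _; rewrite -!EFinM -EFinB lee_fin.
    have k20 : 0 <= k2 * W z by rewrite !mulr_ge0// expR_ge0.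
    have [hb|hb] := pselect (forall i, 1 <= tnth z i <= 2).
      rewrite boxind1// mulr1.
      have /andP[n1 n2] := vnorm_box d_gt0 hb.
      have z0 : 0 < vnorm z by lra.
      rewrite {1 2}(vnormE z0).
      have v0 : 0 <= ln (vnorm z) by rewrite ln_ge0.
      have vV : ln (vnorm z) <= ln (2 * d%:R) by rewrite ler_ln ?posrE//; lra.
      by have := Hcc t x _ t0 tC xA v0 vV; rewrite -/k1; lra.
    rewrite boxind0// mulr0 sub0r.
    have := vnorm_ge0 z; rewrite le_eqVlt => /orP[/eqP <-|z0].
      by rewrite !mulr0 subrr oppr_le0.
    rewrite {1 2}(vnormE z0).
    apply: le_trans (HB' t x (ln (vnorm z)) t0 xA); rewrite lerN2.
    rewrite /k2 -(mulrA _ 3); apply: ler_wpM2l; first by rewrite !mulr_ge0// expR_ge0.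
    by apply: le_trans (vnorm_weight z0); rewrite lerDl expR_ge0.
rewrite integralB//; [|exact: integrableZl|exact: integrableZl].
rewrite !integralZl// HcE qE -!EFinM -EFinB lee_fin /k1 /k2.
have h := HC' t x t0 t1 tC xA.
have hs : s0 / 4 * expR (- (ln x / 4)) <= 1.
  have sx : s0 <= ln x by rewrite -ler_expR lnK.
  have : ln x / 4 <= expR (ln x / 4) by have := expR_ge1Dx (ln x / 4); lra.
  move=> h1; rewrite expRN ler_pdivrMr ?expR_gt0//; lra.
have e4 : expR (- (ln x / 2)) = expR (- (ln x / 4)) * expR (- (ln x / 4)).
  by rewrite -expRD; congr expR; lra.
have e0 := expR_gt0 (- (ln x / 4)).
have i1 : expR (- (ln x / 4)) * expR (- (ln x / 4)) <= expR (- (ln x / 4)) * (C' * L t x).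
  by rewrite ler_pM2l.
have i2 : E * expR (- (ln x / 4)) <= c * q / 2.
  have : 2 * E / (c * q) * expR (- (ln x / 4)) <= 1 by move: hs; rewrite /s0; lra.
  by rewrite mulrAC ler_pdivrMr//; lra.
have i3 : B' * 3 * Hc * (expR (- (ln x / 4)) * (C' * L t x)) <= c * q / 2 * L t x.
  have -> : B' * 3 * Hc * (expR (- (ln x / 4)) * (C' * L t x)) = E * expR (- (ln x / 4)) * L t x.
    by rewrite /E; ring.
  by rewrite ler_pM2r.
have i4 : B' * 3 * Hc * expR (- (ln x / 2)) <= c * q / 2 * L t x.
  by apply: le_trans i3; rewrite e4; apply: ler_wpM2l => //; rewrite !mulr_ge0.
have := ler_wpM2l t0 i4; lra.
Qed.

End transform_bounds.

(** * From the transform to the density *)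

Section density_bounds.
Context (R : realType) (dT : measure_display) (T : measurableType dT) (P : probability T R).
Variables (d : nat) (d_gt0 : (0 < d)%N) (Y : T -> d.-tuple R) (p : R -> R).
Hypothesis mY : measurable_fun setT Y.
Hypothesis p_ge0 : forall r, 0 < r -> 0 <= p r.
Hypothesis p_noninc : forall r s, 0 < r -> r <= s -> p s <= p r.
Hypothesis p_density : forall A : set (d.-tuple R), measurable A ->
  P (Y @^-1` (A `\` [set vzero R d])) =
  leb_int (fun x : d.-tuple R => (\1_(A `\` [set vzero R d]) x * p (vnorm x))%:E).
Hypothesis int_diff : forall lam, P.-integrable setT (fun w => (cauchy_diff (fun i => lam * tnth (Y w) i))%:E).

Let preimage_measurable (A : set (d.-tuple R)) : measurable A -> measurable (Y @^-1` A).
Proof. by move=> mA; rewrite -[X in measurable X]setTI; exact: mY. Qed.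

Lemma vnorm_gt0 (x : d.-tuple R) : x <> vzero R d -> 0 < vnorm x.
Proof.
move=> x0; rewrite lt_neqAle vnorm_ge0 andbT eq_sym; apply/eqP => n0; apply: x0.
apply: eq_from_tnth => i; rewrite tnth_mktuple; apply/eqP.
by have := coord_le_vnorm x i; rewrite n0 normr_le0.
Qed.

(** On the box [[r / (2 d), r / d]^d], which avoids the origin, the norm is at most [r], so the
    density is at least [p r], and the rescaled kernel is bounded below by [cauchy_diff_box]. *)
Lemma density_le (r : R) : 0 < r ->
  (((4 * d%:R * cauchy_small_cst R d)^-1 * (p r * (r / (2 * d%:R)) ^+ d))%:E <=
    \int[P]_w (cauchy_diff (fun i => r^-1 * tnth (Y w) i))%:E)%E.
Proof.
move=> r0.
have d0 : 0 < d%:R :> R by rewrite ltr0n.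
have d1 : 1 <= d%:R :> R by rewrite ler1n.
set k := (4 * d%:R * cauchy_small_cst R d)^-1.
have k0 : 0 <= k by rewrite invr_ge0 !mulr_ge0// ltW// cauchy_small_cst_gt0.
pose a := r / (2 * d%:R); pose b := r / d%:R.
have a0 : 0 < a by rewrite divr_gt0//; lra.
have ba : b = 2 * a by rewrite /a /b; field; rewrite gt_eqF.
have ab : a < b by lra.
pose S : set (d.-tuple R) := boxind a b @^-1` [set 1].
have mS : measurable S.
  by rewrite /S -[X in measurable X]setTI; apply: measurable_boxind.
have box_norm (x : d.-tuple R) : (forall i, a <= tnth x i <= b) -> vnorm x <= r.
  move=> hx; apply: (le_trans (vnorm_le_sum x)).
  apply: (@le_trans _ _ (\sum_(i < d) b)).
    by apply: ler_sum => i _; have /andP[h1 h2] := hx i; rewrite ger0_norm//; lra.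
  by rewrite sumr_const card_ord -[leLHS]mulr_natl /b mulrC divfK// gt_eqF.
have S0 (x : d.-tuple R) : S x -> x <> vzero R d.
  move=> /boxindP/(_ (Ordinal d_gt0)) + x0; rewrite x0 tnth_mktuple; lra.
have h1 : ((p r * a ^+ d)%:E <= P (Y @^-1` S))%E.
  apply: (@le_trans _ _ (P (Y @^-1` (S `\` [set vzero R d])))); last first.
    apply: le_measure; rewrite ?inE; [| |by apply: preimage_subset => x []].
      rewrite (_ : S `\` [set vzero R d] = S); first exact: preimage_measurable.
      by apply/seteqP; split => x; [case|move=> Sx; split => //; exact: S0].
    exact: preimage_measurable.
  rewrite p_density// -(_ : b - a = a); last by rewrite ba; lra.
  rewrite -leb_int_box//; last exact: p_ge0.
  apply: le_leb_int => x.
    by rewrite lee_fin mulr_ge0 ?p_ge0// boxind_ge0.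
  rewrite lee_fin -/(boxind a b x).
  have [hx|hx] := pselect (forall i, a <= tnth x i <= b); last first.
    rewrite boxind0// mulr0 indicE memNset ?mul0r//.
    by move=> [/boxindP].
  have xS : S x by apply/boxindP.
  rewrite boxind1// mulr1 indicE mem_set ?mul1r; last by split => //; exact: S0.
  by apply: p_noninc; [exact/vnorm_gt0/S0|exact: box_norm].
apply: (@le_trans _ _ (k%:E * P (Y @^-1` S))%E).
  by rewrite EFinM lee_wpmul2l ?lee_fin.
have mYS := preimage_measurable mS.
rewrite -[X in P X]setIT -integral_indic// -ge0_integralZl//; last first.
  by apply/measurable_EFinP; exact: measurable_indic.
apply: le_integral_ge0 => w; first by rewrite mule_ge0// lee_fin.
rewrite -EFinM lee_fin indicE.
case: (boolP (w \in Y @^-1` S)) => [|_]; last by rewrite mulr0 cauchy_diff_ge0.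
rewrite inE => /boxindP hw; rewrite mulr1; apply: cauchy_diff_box => // i.
have /andP[w1 w2] := hw i.
have -> : (2 * d%:R)^-1 = r^-1 * a by rewrite /a; field; rewrite !gt_eqF.
have -> : d%:R^-1 = r^-1 * b by rewrite /b; field; rewrite !gt_eqF.
by rewrite !ler_pM2l ?invr_gt0// w1 w2.
Qed.

(** [cauchy_diff_split] at [Y / r], integrated. On the annulus the density is at most [p (r / K)],
    and the annulus lies in a cube of side [2 K r]. *)
Lemma density_ge (r K : R) : 0 < r -> 1 <= K ->
  (\int[P]_w (cauchy_diff (fun i => r^-1 * tnth (Y w) i))%:E <=
    (cauchy_split_cst R d / K ^+ 2)%:E *
     (\int[P]_w (cauchy_diff (fun i => K * r^-1 * tnth (Y w) i))%:E +
      \int[P]_w (cauchy_diff (fun i => r^-1 / K * tnth (Y w) i))%:E) +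
    (p (r / K) * (2 * (K * r)) ^+ d)%:E)%E.
Proof.
move=> r0 K1; have K0 : 0 < K by lra.
have rK0 : 0 < r / K by rewrite divr_gt0.
have Kr0 : 0 < K * r by rewrite mulr_gt0.
pose S : set (d.-tuple R) := (fun x : d.-tuple R => vnorm x) @^-1` `[r / K, K * r]%classic.
have mS : measurable S.
  by rewrite /S -[X in measurable X]setTI; apply: measurable_vnorm.
have mYS := preimage_measurable mS.
have h1 : (P (Y @^-1` S) <= (p (r / K) * (2 * (K * r)) ^+ d)%:E)%E.
  have -> : S = S `\` [set vzero R d].
    apply/seteqP; split => x; last by case.
    move=> Sx; split => // x0; move: Sx; rewrite x0 /S/= in_itv/=.
    have -> : vnorm (vzero R d) = 0.
      by rewrite /vnorm /vdot big1 ?sqrtr0// => i _; rewrite tnth_mktuple mul0r.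
    by move=> /andP[]; lra.
  rewrite p_density//.
  have -> : 2 * (K * r) = K * r - (- (K * r)) by lra.
  rewrite -leb_int_box; [|lra|exact: p_ge0].
  apply: le_leb_int => x; rewrite lee_fin indicE; case: (boolP (x \in _)) => [|_].
  - by rewrite inE => -[_ /vnorm_gt0 x0]; rewrite mul1r p_ge0.
  - by rewrite mul0r.
  - rewrite inE => -[]; rewrite /S/= in_itv/= => /andP[x1 x2] _.
    rewrite mul1r -/(boxind _ _ x) boxind1 ?mulr1; first exact: p_noninc.
    by move=> i; rewrite -ler_norml; exact: le_trans (coord_le_vnorm x i) x2.
  - by rewrite mul0r mulr_ge0 ?p_ge0// boxind_ge0.
have c0 : 0 <= cauchy_split_cst R d / K ^+ 2.
  by rewrite divr_ge0 ?exprn_ge0// ltW// cauchy_split_cst_gt0.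
have mi : measurable_fun setT (fun w => (\1_(Y @^-1` S) w : R)%:E).
  by apply/measurable_EFinP; exact: measurable_indic.
have mD lam := measurable_int _ (int_diff lam).
have D0 lam w : (0 <= (cauchy_diff (fun i => lam * tnth (Y w) i))%:E)%E.
  by rewrite lee_fin cauchy_diff_ge0.
apply: le_trans (leeD (lexx _) h1).
pose D1 w := (cauchy_diff (fun i => K * r^-1 * tnth (Y w) i))%:E.
pose D2 w := (cauchy_diff (fun i => r^-1 / K * tnth (Y w) i))%:E.
pose c := (cauchy_split_cst R d / K ^+ 2)%:E.
have c0E : (0 <= c)%E by rewrite lee_fin.
have m1 : measurable_fun setT D1 by exact: mD.
have m2 : measurable_fun setT D2 by exact: mD.
have m12 : measurable_fun setT (fun w => D1 w + D2 w)%E by exact: emeasurable_funD.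
have mc12 : measurable_fun setT (fun w => c * (D1 w + D2 w))%E by exact: emeasurable_funM.
have n1 w : [set: T] w -> (0 <= D1 w)%E by move=> _; exact: D0.
have n2 w : [set: T] w -> (0 <= D2 w)%E by move=> _; exact: D0.
have n12 w : [set: T] w -> (0 <= D1 w + D2 w)%E by move=> _; rewrite adde_ge0 ?D0.
have nc12 w : [set: T] w -> (0 <= c * (D1 w + D2 w))%E by move=> _; rewrite mule_ge0// n12.
have ni w : [set: T] w -> (0 <= (\1_(Y @^-1` S) w : R)%:E)%E by rewrite lee_fin.
rewrite -[X in P X]setIT -integral_indic//.
rewrite -(ge0_integralD P measurableT n1 m1 n2 m2).
rewrite -(ge0_integralZl P measurableT m12 n12 c0E).
rewrite -(ge0_integralD P measurableT nc12 mc12 ni mi).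
rewrite /c /D1 /D2.
apply: le_integral_ge0 => w //.
suff hh : cauchy_diff (fun i => r^-1 * tnth (Y w) i) <=
    cauchy_split_cst R d / K ^+ 2 * (cauchy_diff (fun i => K * r^-1 * tnth (Y w) i) +
      cauchy_diff (fun i => r^-1 / K * tnth (Y w) i)) + \1_(Y @^-1` S) w.
  by rewrite -lee_fin in hh.
have := @cauchy_diff_split R d d_gt0 K (fun i => r^-1 * tnth (Y w) i) K1 => h.
have e1 : (fun i => K * (r^-1 * tnth (Y w) i)) = (fun i => K * r^-1 * tnth (Y w) i).
  by apply/funext => i; rewrite mulrA.
have e2 : (fun i => r^-1 * tnth (Y w) i / K) = (fun i => r^-1 / K * tnth (Y w) i).
  by apply/funext => i; rewrite mulrAC.
rewrite e1 e2 in h; apply: (le_trans h); rewrite lerD2l indicE.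
have sq : sqnorm (fun i => r^-1 * tnth (Y w) i) = (vnorm (Y w) / r) ^+ 2.
  rewrite expr_div_n sqr_vnorm /sqnorm mulr_suml; apply: eq_bigr => i _.
  by rewrite exprMn exprVn mulrC.
case: (boolP (_ && _)) => // /andP[]; rewrite sq => k1 k2.
rewrite mem_set// /S/= in_itv/=.
have n0 := vnorm_ge0 (Y w).
have q0 : 0 <= vnorm (Y w) / r by rewrite divr_ge0// ltW.
apply/andP; split.
  have : K^-1 <= vnorm (Y w) / r.
    by rewrite -ler_sqr ?nnegrE ?invr_ge0 ?(ltW K0)// exprVn.
  by rewrite ler_pdivlMr// mulrC.
have : vnorm (Y w) / r <= K by rewrite -ler_sqr ?nnegrE ?(ltW K0).
by rewrite ler_pdivrMr.
Qed.

End density_bounds.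

(** * Assembly: choice of the constants and the two-sided bound *)

Lemma continuous_bounded_itv (R : realType) (f : R -> R) (a : R) : 0 <= a -> continuous f ->
  exists B : R, forall u, 0 <= u -> u <= a -> f u <= B.
Proof.
move=> a0 cf; have [c _ hc] := @EVT_max R f 0 a a0 (continuous_subspaceT cf).
by exists (f c) => u u0 ua; apply: hc; rewrite in_itv/= u0 ua.
Qed.

Lemma cauchy_tuple_law (R : realType) (d : nat) : exists (Q : probability (d.-tuple R) R) (Hc q : R),
  [/\ (forall y : 'I_d -> R,
        (\int[Q]_z (cos (\sum_(i < d) tnth z i * y i))%:E = (cauchy_prod y)%:E)%E),
      (\int[Q]_z (\prod_(i < d) weight (tnth z i))%:E = Hc%:E)%E,
      (\int[Q]_z (boxind 1 2 z)%:E = q%:E)%E & 0 < q].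
Proof.
have [m [mcos mw mb]] := cauchy_law R.
have [Q [HQ1 HQ2]] := tuple_law m d; exists Q.
have wfin : (\int[m]_z (weight z)%:E)%E \is a fin_num.
  rewrite ge0_fin_numE//; apply: integral_ge0 => z _; rewrite lee_fin.
  exact: le_trans (weight_ge1 z).
have bfin : (\int[m]_z (\1_(`[1%R, 2%R]) z : R)%:E)%E \is a fin_num.
  apply: integrable_fin_num => //; apply: (@prob_bounded_integrable R _ _ m _ 1) => //.
  by move=> z; rewrite indicE ger0_norm//; case: (_ \in _).
exists (fine (\int[m]_z (weight z)%:E)%E ^+ d), (fine (\int[m]_z (\1_(`[1%R, 2%R]) z : R)%:E)%E ^+ d).
split.
- move=> y; have := HQ2 (fun x => (1 + x ^+ 2)^-1) mcos 0 y.
  by rewrite cos0 mul1r /cauchy_prod => <-; apply: eq_integral => z _; rewrite add0r.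
- rewrite HQ1; [|by move=> x; exact: le_trans (weight_ge1 x)|exact: measurable_weight].
  by rewrite -[in LHS](fineK wfin) EFin_expe.
- rewrite HQ1//.
  by rewrite -[in LHS](fineK bfin) EFin_expe.
- by rewrite exprn_gt0// fine_gt0// mb/= -ge0_fin_numE// ltW.
Qed.

Theorem mainTheorem17
  (R : realType) (dT : measure_display) (T : measurableType dT)
  (P : probability T R) (d : nat) (d_gt0 : (0 < d)%N)
  (X : R -> T -> d.-tuple R)
  (* radial profile g of the Levy density: nu(dx) = g(|x|) dx *)
  (g : R -> R)
  (* radial profile psi of the Levy-Khintchine exponent *)
  (psi : R -> R)
  (* radial profile of the density of X_t on R^d \ {0} *)
  (p : R -> R -> R)
  (l : R -> R)
  (HX : levy_process P X)
  (Hg_nonneg : forall r, 0 < r -> 0 <= g r)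
  (Hg_noninc : forall r s, 0 < r -> r <= s -> g s <= g r)
  (Hg_levy : (leb_int (fun x : d.-tuple R =>
                 (Num.min 1 (vnorm x ^+ 2) * g (vnorm x))%:E) < +oo)%E)
  (Hpsi : forall xi : d.-tuple R,
      psi (vnorm xi) =
      fine (leb_int (fun x : d.-tuple R =>
              ((1 - cos (vdot xi x)) * g (vnorm x))%:E)))
  (Hchar : forall t, 0 <= t -> forall xi : d.-tuple R,
      (\int[P]_w (cos (vdot xi (X t w)))%:E = (expR (- (t * psi (vnorm xi))))%:E)%E
      /\ (\int[P]_w (sin (vdot xi (X t w)))%:E = 0)%E)
  (Hp_nonneg : forall t r, 0 < t -> 0 < r -> 0 <= p t r)
  (Hp_noninc : forall t r s, 0 < t -> 0 < r -> r <= s -> p t s <= p t r)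
  (Hp_density : forall t, 0 < t -> forall A : set (d.-tuple R), measurable A ->
      P (X t @^-1` (A `\` [set vzero R d])) =
      leb_int (fun x : d.-tuple R =>
                 (\1_(A `\` [set vzero R d]) x * p t (vnorm x))%:E))
  (Hl : slowly_varying_inf l)
  (Hl_bounded : exists a M : R, forall x, a <= x -> l x <= M)
  (Hpsi_Pi : Pi_inf l psi) :
  exists r0 t0 C : R, [/\ 0 < r0, 0 < t0, 1 <= C &
    forall (t : R) (x : d.-tuple R), 0 < t < t0 -> 0 < vnorm x <= r0 ->
      C^-1 * (t * (vnorm x ^- d) * l (vnorm x)^-1 * expR (- (t * psi (vnorm x)^-1)))
        <= p t (vnorm x)
      /\ p t (vnorm x)
        <= C * (t * (vnorm x ^- d) * l (vnorm x)^-1 * expR (- (t * psi (vnorm x)^-1)))].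
Proof.
have mX t : 0 <= t -> measurable_fun setT (X t) by case: HX => mX _ _ _ _; exact: mX.
have Hc t : 0 <= t -> forall xi : d.-tuple R,
    (\int[P]_w (cos (vdot xi (X t w)))%:E = (expR (- (t * psi (vnorm xi))))%:E)%E.
  by move=> t0 xi; have [] := Hchar t t0 xi.
have psic := exponent_continuous d_gt0 mX Hc.
have psi0 := exponent_ge0 d_gt0 mX Hc.
have psiec : continuous (fun s => psi (expR s)).
  move=> s; have -> : (fun s => psi (expR s)) = (fun u : R => psi `|u|) \o expR.
    by apply/funext => u /=; rewrite gtr0_norm ?expR_gt0.
  by apply: continuous_comp; [exact: continuous_expR|exact: psic].
have [A [C tame]] := tame_exponentP Hl Hl_bounded Hpsi_Pi psiec.
have [A1 C1] : 1 <= A /\ 1 <= C by case: tame.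
have A2 : 0 <= 2 * A by lra.
have [B HB] := continuous_bounded_itv A2 psic.
have psiB u : 0 <= u -> u <= 2 * A -> psi u <= B.
  by move=> u0 uA; have := HB u u0 uA; rewrite ger0_norm.
have [Q [Hw [q [HQ HwE qE q0]]]] := cauchy_tuple_law R d.
pose L t x := l x * expR (- (t * psi x)).
pose U t x := fine (\int[P]_w (cauchy_diff (fun i => x * tnth (X t w) i))%:E)%E.
have intD t x : 0 <= t -> 0 <= x -> Q.-integrable setT (fun z : d.-tuple R =>
    (expR (- (t * psi (x * vnorm z))) - expR (- (t * psi (2 * (x * vnorm z)))))%:E).
  move=> t0 x0.
  have -> : (fun z : d.-tuple R =>
      (expR (- (t * psi (x * vnorm z))) - expR (- (t * psi (2 * (x * vnorm z)))))%:E) =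
    (fun z : d.-tuple R => (expR (- (t * psi (x * vnorm z))))%:E -
      (expR (- (t * psi (2 * x * vnorm z))))%:E)%E.
    by apply/funext => z; rewrite EFinB mulrA.
  apply: integrableB => //; apply: (integrable_expR_exponent d_gt0 mX Hc) => //.
  by rewrite mulr_ge0.
have intU t x : 0 <= t ->
    P.-integrable setT (fun w => (cauchy_diff (fun i => x * tnth (X t w) i))%:E).
  move=> t0.
  have -> : (fun w => (cauchy_diff (fun i => x * tnth (X t w) i))%:E) =
    (fun w => (cauchy_prod (fun i => x * tnth (X t w) i))%:E -
      (cauchy_prod (fun i => 2 * x * tnth (X t w) i))%:E)%E.
    apply/funext => w; rewrite /cauchy_diff EFinB; congr (_ - _)%E.
    by congr (cauchy_prod _)%:E; apply/funext => i; rewrite mulrA.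
  by apply: integrableB => //; exact: (integrable_cauchy_prod P mX).
have UE t x : 0 <= t ->
    (\int[P]_w (cauchy_diff (fun i => x * tnth (X t w) i))%:E = (U t x)%:E)%E.
  by move=> t0; rewrite /U fineK// integrable_fin_num//; exact: intU.
have [CU CU0 HCU] := transform_upper tame psi0 psiB HwE intD.
have [cU [x0 [cU0 x0A HcU]]] := transform_lower d_gt0 tame psi0 psiB HwE qE q0 intD.
have U_le t x : 0 <= t -> t <= 1 -> t * C <= 1 / 8 -> A <= x -> U t x <= t * (CU * L t x).
  move=> t0 t1 tC xA; rewrite -lee_fin -UE// (expectation_cauchy_diff d_gt0 mX Hc HQ)//; last lra.
  exact: HCU.
have U_ge t x : 0 <= t -> t <= 1 -> t * C <= 1 / 8 -> x0 <= x -> t * (cU * L t x) <= U t x.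
  move=> t0 t1 tC xA; rewrite -lee_fin -UE// (expectation_cauchy_diff d_gt0 mX Hc HQ)//; last lra.
  exact: HcU.
pose k := (4 * d%:R * cauchy_small_cst R d)^-1.
pose C0 := cauchy_split_cst R d.
have d0 : 0 < d%:R :> R by rewrite ltr0n.
have k0 : 0 < k by rewrite invr_gt0 !mulr_gt0// cauchy_small_cst_gt0.
have C00 : 0 < C0 by exact: cauchy_split_cst_gt0.
have p_le t r : 0 < t -> 0 < r -> k * (p t r * (r / (2 * d%:R)) ^+ d) <= U t r^-1.
  move=> t0 r0; have tt := ltW t0; rewrite -lee_fin -UE//.
  exact: (density_le d_gt0 (mX t tt) (fun r => Hp_nonneg t r t0) (fun r s => Hp_noninc t r s t0)
    (Hp_density t t0) r0).
have p_ge t r K : 0 < t -> 0 < r -> 1 <= K -> U t r^-1 <=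
    C0 / K ^+ 2 * (U t (K * r^-1) + U t (r^-1 / K)) + p t (r / K) * (2 * (K * r)) ^+ d.
  move=> t0 r0 K1; have tt := ltW t0; rewrite -lee_fin EFinD EFinM EFinD -!UE//.
  exact: (density_ge d_gt0 (mX t tt) (fun r => Hp_nonneg t r t0) (fun r s => Hp_noninc t r s t0)
    (Hp_density t t0) (fun lam => intU t lam tt) r0 K1).
pose E := C * expR 1.
have E0 : 0 < E by rewrite mulr_gt0 ?expR_gt0//; lra.
(* The power 1/4 is weakened to 1, which is still beaten by the gain [K^-2] of the kernel. *)
have cmp t x v : 0 <= t -> t * C <= 1 / 8 -> A <= x -> A <= x * expR v ->
    L t (x * expR v) <= E * expR `|v| * L t x.
  move=> t0 tC xA yA; apply: (le_trans (profile_compare tame t0 tC xA yA)).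
  rewrite ler_pM2r ?(profile_gt0 tame)// /E -mulrA -expRD ler_pM2l; last lra.
  by rewrite ler_expR; have := normr_ge0 v; lra.
(* Each of the two dilated terms costs [C0 * CU * E / K] times [t * L t r^-1]; with this [K] their
   sum is at most [cU / 2] times it, half of the lower bound for [U]. *)
pose K := Num.max 1 (4 * C0 * CU * E / cU).
have K1 : 1 <= K by rewrite le_max lexx.
have K0 : 0 < K by lra.
have KE : 4 * C0 * CU * E <= cU * K.
  by rewrite (mulrC cU) -ler_pdivrMr// le_max lexx orbT.
have lnK0 : 0 <= ln K by rewrite ln_ge0.
have expK : expR (ln K) = K by rewrite lnK.
have expNK : expR (- ln K) = K^-1 by rewrite expRN expK.
(* The second entry keeps the contracted frequency [r^-1 / K] above [A]. *)
pose x1 := Num.max x0 (K * A).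
have x1A : A <= x1 by rewrite le_max x0A.
have x1K : K * A <= x1 by rewrite le_max lexx orbT.
have x10 : x0 <= x1 by rewrite le_max lexx.
have x1p : 0 < x1 by lra.
have cmpK t x : 0 <= t -> t * C <= 1 / 8 -> A <= x -> L t (K * x) <= E * K * L t x.
  move=> t0 tC xA; have := @cmp t x (ln K) t0 tC xA; rewrite expK ger0_norm// expK (mulrC x).
  by apply; apply: (le_trans xA); rewrite ler_peMl//; lra.
have cmpV t x : 0 <= t -> t * C <= 1 / 8 -> K * A <= x -> L t (x / K) <= E * K * L t x.
  move=> t0 tC xA; have := @cmp t x (- ln K) t0 tC.
  rewrite expNK normrN ger0_norm// expK; apply.
    by apply: le_trans xA; rewrite ler_peMl//; lra.
  by rewrite ler_pdivlMr// mulrC.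
have step t r : 0 < t -> t <= 1 -> t * C <= 1 / 8 -> 0 < r -> x1 <= r^-1 ->
    t * (cU / 2 * L t r^-1) <= p t (r / K) * (2 * (K * r)) ^+ d.
  move=> t0 t1 tC r0 rx.
  have tt := ltW t0.
  have u0 : x0 <= r^-1 by lra.
  have uA : A <= r^-1 by lra.
  have uK : K * A <= r^-1 by lra.
  have Lp : 0 < L t r^-1 by exact: (profile_gt0 tame).
  have b1 := U_ge t r^-1 tt t1 tC u0.
  have b2 := p_ge t r K t0 r0 K1.
  have b3 : U t (K * r^-1) <= t * (CU * (E * K * L t r^-1)).
    have AK : A <= K * r^-1 by apply: (le_trans uA); rewrite ler_peMl//; lra.
    apply: (le_trans (U_le t _ tt t1 tC AK)); rewrite ler_pM2l// ler_pM2l//; exact: cmpK.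
  have b4 : U t (r^-1 / K) <= t * (CU * (E * K * L t r^-1)).
    have AK : A <= r^-1 / K by rewrite ler_pdivlMr// mulrC.
    apply: (le_trans (U_le t _ tt t1 tC AK)); rewrite ler_pM2l// ler_pM2l//; exact: cmpV.
  have cK : 0 <= C0 / K ^+ 2 by rewrite divr_ge0 ?exprn_ge0// ltW.
  have b5 : C0 / K ^+ 2 * (U t (K * r^-1) + U t (r^-1 / K)) <= t * (cU / 2 * L t r^-1).
    apply: (le_trans (ler_wpM2l cK (lerD b3 b4))).
    have -> : C0 / K ^+ 2 * (t * (CU * (E * K * L t r^-1)) + t * (CU * (E * K * L t r^-1))) =
      t * (4 * C0 * CU * E / K * (L t r^-1 / 2)) by field; rewrite gt_eqF.
    rewrite ler_pM2l//.
    have -> : cU / 2 * L t r^-1 = cU * (L t r^-1 / 2) by ring.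
    rewrite ler_pM2r; last by rewrite divr_gt0.
    by rewrite ler_pdivrMr.
  lra.
pose M1 := CU / k * (2 * d%:R) ^+ d.
pose M2 := 2 * E * K * (2 * K ^+ 2) ^+ d / cU.
have M10 : 0 < M1 by rewrite mulr_gt0 ?divr_gt0// exprn_gt0// mulr_gt0.
have K2 : 0 < K ^+ 2 by rewrite exprn_gt0.
have K2d : 0 < (2 * K ^+ 2) ^+ d by apply: exprn_gt0; lra.
have M20 : 0 < M2.
  by rewrite /M2; apply: divr_gt0 cU0; apply: mulr_gt0 K2d; apply: mulr_gt0 K0; rewrite mulr_gt0.
(* The factor [K] in the radius is there because [step] bounds the density at its radius divided by
   [K], so it is used at [K * r]. The bound on [t] gives [t * C <= 1 / 8], hence also [t <= 1] since
   [C >= 1]. *)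
exists (K * x1)^-1, (8 * C)^-1, (1 + M1 + M2); split.
- by rewrite invr_gt0 mulr_gt0.
- by rewrite invr_gt0; lra.
- lra.
move=> t x /andP[t0 tt0] /andP[r0 rr0]; set r := vnorm x in r0 rr0 *.
have tC : t * C <= 1 / 8.
  have : t * (8 * C) < 1 by rewrite -ltr_pdivlMr ?mul1r//; lra.
  lra.
have t1 : t <= 1.
  have : t * 1 <= t * C by rewrite ler_pM2l.
  lra.
have tt := ltW t0.
have ru : K * x1 <= r^-1 by rewrite -[leLHS]invrK lef_pV2 ?posrE ?invr_gt0 ?mulr_gt0.
have x1Kx : x1 <= K * x1 by rewrite ler_peMl//; lra.
have uA : A <= r^-1 by lra.
have Lp : 0 < L t r^-1 by exact: (profile_gt0 tame).
have rd : 0 < r ^+ d by rewrite exprn_gt0.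
have -> : t * r ^- d * l r^-1 * expR (- (t * psi r^-1)) = t * (L t r^-1 / r ^+ d).
  by rewrite /L; ring.
have G0 : 0 < t * (L t r^-1 / r ^+ d) by rewrite mulr_gt0// divr_gt0.
have up : p t r <= M1 * (t * (L t r^-1 / r ^+ d)).
  have h := le_trans (p_le t r t0 r0) (U_le t r^-1 tt t1 tC uA).
  have -> : M1 * (t * (L t r^-1 / r ^+ d)) =
      t * (CU * L t r^-1) / (k * (r / (2 * d%:R)) ^+ d).
    rewrite /M1 expr_div_n.
    have n1 : r ^+ d != 0 by rewrite gt_eqF.
    have n2 : (2 * d%:R) ^+ d != 0 :> R by rewrite gt_eqF// exprn_gt0// mulr_gt0.
    have n3 : k != 0 by rewrite gt_eqF.
    by field; rewrite n1 n2 n3.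
  rewrite ler_pdivlMr; last by rewrite mulr_gt0// exprn_gt0// divr_gt0// mulr_gt0.
  by apply: le_trans h; rewrite mulrCA.
have lo : t * (L t r^-1 / r ^+ d) <= M2 * p t r.
  have Kr : 0 < K * r by rewrite mulr_gt0.
  have Kru : x1 <= (K * r)^-1.
    by rewrite invfM mulrC ler_pdivlMr// mulrC.
  have h := step t (K * r) t0 t1 tC Kr Kru.
  have eK : K * r / K = r by rewrite mulrAC mulfV ?mul1r// gt_eqF.
  rewrite eK in h.
  have h2 : L t r^-1 <= E * K * L t (K * r)^-1.
    have := cmpK t (K * r)^-1 tt tC; rewrite invfM mulrA mulfV ?gt_eqF// mul1r; apply.
    by rewrite -invfM; lra.
  have h3 : t * L t r^-1 <= 2 * E * K / cU * (p t r * (2 * (K * (K * r))) ^+ d).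
    apply: (@le_trans _ _ (2 * E * K / cU * (t * (cU / 2 * L t (K * r)^-1)))); last first.
      apply: ler_wpM2l h; apply/ltW; apply: divr_gt0 cU0; apply: mulr_gt0 K0.
      by rewrite mulr_gt0.
    have -> : 2 * E * K / cU * (t * (cU / 2 * L t (K * r)^-1)) = t * (E * K * L t (K * r)^-1).
      by field; rewrite gt_eqF.
    by rewrite ler_pM2l.
  rewrite mulrA ler_pdivrMr//; apply: (le_trans h3).
  have -> : 2 * (K * (K * r)) = 2 * K ^+ 2 * r by ring.
  rewrite exprMn /M2 le_eqVlt; apply/orP; left; apply/eqP.
  move: ((2 * K ^+ 2) ^+ d) (r ^+ d) => a b.
  by field; rewrite gt_eqF.
have p0 : 0 <= p t r by exact: Hp_nonneg.
split.
  rewrite mulrC ler_pdivrMr; last lra.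
  have : M2 * p t r <= p t r * (1 + M1 + M2).
    by rewrite mulrC ler_wpM2l//; lra.
  lra.
apply: (le_trans up); rewrite ler_pM2r//; lra.
Qed.
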